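(* Let $n\in\{4,5,6,7\}$ and let $\mathbf{e}=(e_1,\ldots,e_n)\in\mathbb{Z}^n$ with $e_1\cdots e_n\neq 0$. For every $\varepsilon>0$ there is a constant $C=C(n,\mathbf{e},\varepsilon)>0$ such that the following holds. For any prime $p$, any positive integer $h\le p$, any integers $k_1,\ldots,k_n$ with corresponding cube $\mathcal{B}=[k_1+1,k_1+h]\times\cdots\times[k_n+1,k_n+h]$, any complex-valued weights $\boldsymbol{\rho}=(\rho_1,\ldots,\rho_n)$ with $|\rho_j(x)|\le 1$ for all $x\in\mathbb{R}$ and $j=1,\ldots,n$, any nontrivial multiplicative character $\chi$ modulo $p$, and any integer $\lambda$ with $\gcd(\lambda,p)=1$, we have $$ |T_p(\lambda,\chi,\boldsymbol{\rho},\mathbf{e};\mathcal{B})|\le C\,h^{\varepsilon}\cdot \begin{cases} h^{2}p^{1/2}+h^{4}p^{-1/2} & \text{if } n=4,\\ h^{5/2}p^{1/2}+h^{4}p^{1/8}+h^{5}p^{-3/8} & \text{if } n=5,\\ h^{3}p^{1/2}+h^{6}p^{-1/4} & \text{if } n=6,\\ h^{11/2}p^{1/4}+h^{7}p^{-1/8} & \text{if } n=7. \end{cases} $$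
   Context: The sum is $$ T_p(\lambda,\chi,\boldsymbol{\rho},\mathbf{e};\mathcal{B})=\sum_{\substack{(x_1,\ldots,x_n)\in\mathcal{B}\\ x_1\cdots x_n\not\equiv 0 \pmod p}}\rho_1(x_1)\cdots\rho_n(x_n)\,\chi(x_1^{e_1}\cdots x_n^{e_n}+\lambda), $$ where the summation is over integer vectors $(x_1,\ldots,x_n)$ in $\mathcal{B}$, for a negative exponent $e$ the power $x^e$ is computed with the inverse of $x$ modulo $p$ (so $x_1^{e_1}\cdots x_n^{e_n}+\lambda$ is a residue class modulo $p$), and $\chi(0)=0$. *)

(* Defs.v *)
From HB Require Import structures.
From mathcomp Require Import all_boot all_order all_algebra.
From mathcomp Require Import all_classical all_reals all_analysis.
From mathcomp Require Import complex.

Set Implicit Arguments.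
Unset Strict Implicit.
Unset Printing Implicit Defensive.

Import Order.TTheory GRing.Theory Num.Theory.
Import numFieldNormedType.Exports.

Local Open Scope classical_set_scope.
Local Open Scope ring_scope.

(* A multiplicative character modulo a prime p: a character of the group of
   units of 'F_p, extended to 'F_p by chi 0 = 0. *)
Definition mul_character (R : realType) (p : nat) (chi : 'F_p -> R[i]) : Prop :=
  monoid_morphism chi /\ chi 0 = 0.

Definition nontrivial_character (R : realType) (p : nat)
    (chi : 'F_p -> R[i]) : Prop :=
  exists2 x : 'F_p, x != 0 & chi x <> 1.

Definition cube (n : nat) (k : 'I_n -> int) (h : nat) :
    set {ffun 'I_n -> int} :=
  [set x | forall j, k j + 1 <= x j <= k j + h%:Z].

(* The finitely supported sum in charsum is defined to be 0 on infinite
   supports; this never happens for a cube. *)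
Lemma cube_finite (n : nat) (k : 'I_n -> int) (h : nat) :
  finite_set (cube k h).
Proof.
pose f (i : {ffun 'I_n -> 'I_h.+1}) := [ffun j => k j + (i j : nat)%:Z].
apply: (@sub_finite_set _ _ (f @` [set: _])); last first.
  exact/finite_image/finite_finset.
move=> x xB; exists [ffun j => inord `|x j - k j|%N] => //.
apply/ffunP => j; rewrite !ffunE.
have /andP[lo hi] := xB j.
have d0 : 0 <= x j - k j by rewrite subr_ge0 (le_trans _ lo) // lerDl.
rewrite inordK; first by rewrite gez0_abs // subrKC.
by rewrite ltnS -lez_nat gez0_abs // lerBlDl.
Qed.

(* The power x ^ e with e : int is taken in the field 'F_p, so that for e < 0
   it is computed with the inverse of x modulo p. *)
Definition charsum (R : realType) (p n : nat) (lambda : int)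
    (chi : 'F_p -> R[i]) (rho : 'I_n -> R -> R[i]) (e : 'I_n -> int)
    (B : set {ffun 'I_n -> int}) : R[i] :=
  \sum_(x \in B `&` [set x | ~~ (p %| \prod_(j < n) x j)%Z])
    (\prod_(j < n) rho j (x j)%:~R) *
    chi (\prod_(j < n) ((x j)%:~R : 'F_p) ^ e j + lambda%:~R).

(* The value 0 for n outside {4, 5, 6, 7} is a dummy. *)
Definition charsum_bound (R : realType) (n h p : nat) : R :=
  let H : R := h%:R in
  let P : R := p%:R in
  match n with
  | 4 => H `^ 2 * P `^ (1 / 2) + H `^ 4 * P `^ (- (1 / 2))
  | 5 => H `^ (5 / 2) * P `^ (1 / 2) + H `^ 4 * P `^ (1 / 8)
         + H `^ 5 * P `^ (- (3 / 8))
  | 6 => H `^ 3 * P `^ (1 / 2) + H `^ 6 * P `^ (- (1 / 4))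
  | 7 => H `^ (11 / 2) * P `^ (1 / 4) + H `^ 7 * P `^ (- (1 / 8))
  | _ => 0
  end.

(* Main.v *)
Require Import Defs.
From mathcomp Require Import all_boot all_order all_algebra.
From mathcomp Require Import all_fingroup all_character all_field.
From mathcomp Require Import zify ring.

(** Split the n variables into two groups and write the sum as a bilinear form
    in the values a, b of the two partial monomials.  By Cauchy-Schwarz and the
    orthogonality of chi, the square of the bilinear form is at most p times the
    product of the multiplicative energies of the two groups, an energy being
    the number of solutions of a(x) = a(x').  Fourier analysis on the unit group
    replaces mixed exponents and intervals by pure ones, at the cost of a factor
    depending on e only.

    For an interval of length H, the energy of two variables is H^(2+o(1)) if
    H^2 <= p, that of three variables is H^(3+o(1)) if H^4 <= p, and a fourth
    variable costs at most H^2.  For two or three variables, subtracting the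
    two products gives a polynomial of degree at most 1 or 2 with small
    coefficients that vanishes at the left endpoint s modulo p.  Given this
    polynomial and one variable y_1, evaluation at -y_1 determines the product
    of the x_i - y_1, hence the x_i up to a divisor function.  For three
    variables the possible quadratic polynomials are counted in the lattice of
    the (u, v) with u s + v = 0 mod p: if it has no short vector there are
    O(H^2) of them, and otherwise s is a fraction with small numerator and
    denominator, and the solutions not covered by such a count satisfy an
    equation between products of integers, again controlled by divisors.

    Longer intervals are cut into blocks of the largest admissible length.  For
    n = 7 and h < p^(1/6) the trivial bound suffices. *)

Set Implicit Arguments.
Unset Strict Implicit.
Unset Printing Implicit Defensive.

Import Order.TTheory GRing.Theory Num.Theory.

(** * Bounds for the divisor function *)

Lemma size_divisorsM m n : 0 < m -> 0 < n ->
  size (divisors (m * n)) <= size (divisors m) * size (divisors n).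
Proof.
move=> m0 n0.
have mn0 : 0 < m * n by rewrite muln_gt0 m0.
rewrite -(size_allpairs pair).
(* Injective on the divisors of [m * n], because the product of the two components is [d]. *)
pose f d := (gcdn d m, d %/ gcdn d m).
rewrite -(size_map f); apply: uniq_leq_size.
  rewrite map_inj_in_uniq ?divisors_uniq // => c d _ _ [e1 e2].
  by rewrite -(divnK (dvdn_gcdl c m)) e2 e1 divnK ?dvdn_gcdl.
move=> x /mapP[d]; rewrite -dvdn_divisors // => dmn ->.
apply: allpairs_f; rewrite -dvdn_divisors ?dvdn_gcdr //.
have g0 : 0 < gcdn d m by rewrite gcdn_gt0 m0 orbT.
rewrite -(@dvdn_pmul2r (gcdn d m)) // divnK ?dvdn_gcdl // muln_gcdr.
by rewrite dvdn_gcd dvdn_mull // mulnC.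
Qed.

Lemma size_divisorsX q e : prime q -> size (divisors (q ^ e)) <= e.+1.
Proof.
move=> pq; rewrite -(size_iota 0 e.+1) -(size_map (expn q) (iota _ _)).
apply: uniq_leq_size; first exact: divisors_uniq.
move=> d; rewrite -dvdn_divisors ?expn_gt0 ?prime_gt0 // => /(dvdn_pfactor _ _ pq).
by case=> // i ie ->; apply/map_f; rewrite mem_iota.
Qed.

(** With q the integer part of e / k, e < k (q + 1) and q + 1 <= 2^q give e + 1 <= k 2^q; then take
    k-th powers. *)
Lemma succ_expn_le k e : e.+1 ^ k <= k ^ k * 2 ^ e.
Proof.
case: k => [|k]; first by rewrite !expn0 mul1n expn_gt0.
set K := k.+1.
have le1 : e.+1 <= K * 2 ^ (e %/ K).
  have h1 : e %/ K < 2 ^ (e %/ K) by rewrite ltn_expl.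
  have h2 : e < K * (e %/ K).+1 by rewrite mulnC ltn_ceil.
  exact: leq_trans h2 (leq_mul (leqnn K) h1).
apply: (@leq_trans ((K * 2 ^ (e %/ K)) ^ K)); first by rewrite leq_exp2r.
by rewrite expnMn -expnM leq_mul // leq_exp2l // leq_divM.
Qed.

(* In tau(N)^k / N only the primes below 2^k contribute a factor exceeding 1. *)
Lemma size_divisors_pow k :
  exists C, forall N, 0 < N -> size (divisors N) ^ k <= C * N.
Proof.
case: (posnP k) => [->|k0]; first by exists 1 => N; rewrite mul1n expn0.
pose C0 := (k ^ k).+1; exists (C0 ^ (2 ^ k)) => N N0.
(* Induction on the range of the primes; each integer below [2 ^ k] is allowed one factor [C0], the
   larger ones none. *)
have step (b : nat) : size (divisors (\prod_(0 <= q < b | prime q) q ^ logn q N)) ^ k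
    <= C0 ^ (minn b (2 ^ k)) * \prod_(0 <= q < b | prime q) q ^ logn q N.
  elim: b => [|b IH].
    by rewrite big_geq // min0n expn0 muln1 (_ : divisors 1 = [:: 1]) // exp1n.
  have b1 : minn b (2 ^ k) <= minn b.+1 (2 ^ k).
    by rewrite leq_min geq_minr (leq_trans (geq_minl _ _)).
  have mono : C0 ^ minn b (2 ^ k) <= C0 ^ minn b.+1 (2 ^ k) by rewrite leq_pexp2l.
  rewrite big_mkcond big_nat_recr //= -big_mkcond /=.
  case: ifP => [pb|_]; last first.
    by rewrite !muln1 (leq_trans IH) // leq_mul2r mono orbT.
  set M := \prod_(_ <= _ < _ | _) _ in IH *.
  have M0 : 0 < M by apply: prodn_cond_gt0 => q pq; rewrite expn_gt0 prime_gt0.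
  have q0 : 0 < b ^ logn b N by rewrite expn_gt0 prime_gt0.
  apply: (@leq_trans (size (divisors M) ^ k * (logn b N).+1 ^ k)).
    rewrite -expnMn leq_exp2r //; apply: leq_trans (size_divisorsM M0 q0) _.
    by rewrite leq_mul2l size_divisorsX ?orbT.
  set l := logn b N in q0 *.
  (* A small prime is covered by [succ_expn_le]. For a large one, l + 1 <= 2^l gives (l + 1)^k <=
     (2^k)^l <= b^l. *)
  have [lt|ge] := ltnP b (2 ^ k).
    apply: (@leq_trans (C0 ^ b * M * (C0 * b ^ l))).
      rewrite (minn_idPl (ltnW lt)) in IH.
      apply: leq_mul IH _; apply: leq_trans (succ_expn_le k l) _.
      apply: leq_mul; first exact: leqnSn.
      by case: (l) => // j; rewrite leq_exp2r // prime_gt1.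
    by rewrite (minn_idPl lt) expnS; lia.
  rewrite (minn_idPr ge) in IH; rewrite (minn_idPr (leqW ge)) mulnA.
  apply: leq_mul IH _; apply: (@leq_trans (2 ^ (l * k))).
    by rewrite expnM leq_exp2r // ltn_expl.
  by rewrite mulnC expnM; case: (l) => // j; rewrite leq_exp2r.
have eN : N = \prod_(0 <= q < N.+1 | prime q) q ^ logn q N.
  rewrite -{1}(partnT N0) /partn.
  rewrite [LHS]big_mkcond [RHS]big_mkcond; apply: eq_bigr => q _ /=.
  by case: ifP => // /negbT npq; rewrite lognE (negPf npq).
rewrite {2}eN; have := step N.+1; rewrite -eN => h; apply: leq_trans h _.
by rewrite leq_mul2r leq_pexp2l ?geq_minr ?orbT.
Qed.

Local Open Scope ring_scope.

(** * Counting through the fibres of a map *)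

Lemma card_fibers (T : finType) (K : eqType) (f : T -> K) (A : {set T})
    (s : seq K) (m : nat) :
  {in A, forall x, f x \in s} ->
  {in A, forall x, #|[set y in A | f y == f x]| <= m}%N ->
  (#|A| <= size s * m)%N.
Proof.
elim: s A => [|k s IH] A fs fm.
  by rewrite leqn0 cards_eq0; apply/eqP/setP=> x; rewrite inE; apply/negP=> /fs.
rewrite -(cardsID [set y | f y == k] A) mulSn leq_add //.
  have [E|[x]] := set_0Vmem (A :&: [set y | f y == k]); first by rewrite E cards0.
  rewrite !inE => /andP[xA /eqP <-]; rewrite (leq_trans _ (fm x xA)) //.
  by apply/subset_leq_card/subsetP=> y; rewrite !inE.
apply: IH => x; rewrite !inE => /andP[nk xA].
  by have := fs x xA; rewrite inE (negPf nk).
rewrite (leq_trans _ (fm x xA)) //; apply/subset_leq_card/subsetP=> y.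
by rewrite !inE => /andP[/andP[_ ->] ->].
Qed.

Lemma card_fibers_set (T K : finType) (f : T -> K) (A : {set T}) (B : {set K})
    (m : nat) :
  {in A, forall x, f x \in B} ->
  {in A, forall x, #|[set y in A | f y == f x]| <= m}%N ->
  (#|A| <= #|B| * m)%N.
Proof.
by move=> fB fm; rewrite (cardE B); apply: card_fibers fm => x /fB; rewrite mem_enum.
Qed.

Lemma card_le1_eq (T : finType) (A : {set T}) :
  {in A &, forall x y, x = y} -> (#|A| <= 1)%N.
Proof. by move=> h; apply/card_le1_eqP => x y xA yA; exact: h. Qed.

(** All values of [f] lie in one residue class modulo [d] and within distance [M] of a fixed one,
    which leaves at most 2 (M / d) + 1 of them. *)
Lemma card_fibers_modz (T : finType) (f : T -> int) (A : {set T}) (d M m : nat) :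
  (0 < d)%N ->
  {in A &, forall x y, (d %| f x - f y)%Z} ->
  {in A &, forall x y, `|f x - f y| <= M%:Z} ->
  {in A, forall x, #|[set y in A | f y == f x]| <= m}%N ->
  (#|A| <= (2 * (M %/ d) + 1) * m)%N.
Proof.
move=> d0 fd fM fm; have [->|[a aA]] := set_0Vmem A; first by rewrite cards0.
set q := (M %/ d)%N.
pose s := [seq f a + (i%:Z - q%:Z) * d%:Z | i <- iota 0 (2 * q + 1)].
rewrite -(size_iota 0 (2 * q + 1)).
have <- : size s = size (iota 0 (2 * q + 1)) by rewrite size_map.
apply: card_fibers fm => x xA.
have /dvdzP[t et] := fd x a xA aA; have := fM x a xA aA; rewrite et => le.
have tq : `|t| <= q%:Z.
  rewrite -abszE lez_nat leq_divRL //.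
  by rewrite -lez_nat PoszM abszE -[d%:Z]ger0_norm // -normrM.
apply/mapP; exists (absz (t + q%:Z)).
  by rewrite mem_iota; lia.
rewrite gez0_abs; last by lia.
by rewrite addrK -et addrC subrK.
Qed.

(** The factor 2 accounts for the negative divisors. *)
Lemma card_fibers_divisor (T : finType) (f : T -> int) (A : {set T}) (N : int)
    (D m : nat) :
  N != 0 -> (size (divisors `|N|) <= D)%N ->
  {in A, forall x, (f x %| N)%Z} ->
  {in A, forall x, #|[set y in A | f y == f x]| <= m}%N ->
  (#|A| <= (2 * D) * m)%N.
Proof.
move=> N0 ND fN fm.
pose s := [seq d%:Z | d <- divisors `|N|] ++ [seq - d%:Z | d <- divisors `|N|].
have ss : (size s <= 2 * D)%N by rewrite size_cat !size_map; lia.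
apply: leq_trans (_ : size s * m <= _)%N; last by rewrite leq_mul2r ss orbT.
apply: card_fibers fm => x /fN; rewrite dvdzE => h.
have fs : `|f x|%N \in divisors `|N| by rewrite -dvdn_divisors // absz_gt0.
rewrite mem_cat; have [fx0|fx0] := leP 0 (f x); apply/orP; [left|right].
  by apply/mapP; exists `|f x|%N => //; rewrite gez0_abs.
by apply/mapP; exists `|f x|%N => //; lia.
Qed.

(** * Congruences in two variables from a short interval *)

Lemma Euclid_dvdzM (p : nat) (a b : int) : prime p ->
  (p %| a * b)%Z = (p %| a)%Z || (p %| b)%Z.
Proof. by move=> pp; rewrite !dvdzE abszM Euclid_dvdM. Qed.

Lemma dvdzB (d a b : int) : (d %| a)%Z -> (d %| b)%Z -> (d %| a - b)%Z.
Proof. exact: rpredB. Qed.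

Lemma dvdz_eqr (d a b : int) : a = b -> (d %| a)%Z -> (d %| b)%Z.
Proof. by move->. Qed.

Lemma dvdz_small_eq0 (d : nat) (z : int) : (d %| z)%Z -> `|z| < d%:Z -> z = 0.
Proof.
move=> dz zd; apply/eqP; rewrite -absz_eq0; apply/contraTT: dz => z0.
by rewrite dvdzE gtnNdvd ?lt0n // -ltz_nat abszE.
Qed.

Lemma window_absz (H : nat) (a b : int) : 0 <= a < H%:Z -> 0 <= b < H%:Z -> (`|a - b| <= H)%N.
Proof. lia. Qed.

Lemma leq_abszB (M : nat) (x y : int) :
  (`|x| <= M)%N -> (`|y| <= M)%N -> `|x - y| <= (2 * M)%N%:Z.
Proof. lia. Qed.

Lemma window2_le (H : nat) (x1 x2 y1 y2 : int) :
  0 <= x1 < H%:Z -> 0 <= x2 < H%:Z -> 0 <= y1 < H%:Z -> 0 <= y2 < H%:Z ->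
  (`|(x1 + x2 - y1 - y2)%R| <= 2 * H)%N /\ (`|(x1 * x2 - y1 * y2)%R| <= H ^ 2)%N.
Proof.
move=> X1 X2 Y1 Y2; split; first by lia.
have two a b : 0 <= a < H%:Z -> 0 <= b < H%:Z -> 0 <= a * b <= (H ^ 2)%N%:Z.
  move=> /andP[a0 aH] /andP[b0 bH]; rewrite mulr_ge0 //= -mulnn PoszM.
  by apply: ler_pM => //; apply: ltW.
move: (two _ _ X1 X2) (two _ _ Y1 Y2).
by move: (x1 * x2) (y1 * y2) (H ^ 2)%N; clear; lia.
Qed.

Section Congruence.
Variables (X : finType) (g : X -> int) (B : {set X}) (H D p : nat) (s : int).
Hypothesis g_inj : {in B &, injective g}.
Hypothesis g_window : {in B, forall x, 0 <= g x < H%:Z}.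
Hypothesis p_prime : prime p.
Hypothesis B_unit : {in B, forall x, ~~ (p %| s + g x)%Z}.
Hypothesis tauD : forall N, (0 < N <= 8 * H ^ 6)%N -> (size (divisors N) <= D)%N.

Lemma card_window : (#|B| <= H)%N.
Proof.
rewrite -[H]muln1 -(size_iota 0 H) -(size_map Posz).
apply: (@card_fibers _ _ g) => x xB.
  by apply/mapP; exists `|g x|%N; rewrite ?mem_iota;
    move: (g x) (g_window xB); clear; lia.
apply: card_le1_eq => y z; rewrite !inE => /andP[yB /eqP ey] /andP[zB /eqP ez].
by apply: g_inj => //; rewrite ey.
Qed.

(** An index [x] in [B] stands for the integer [s + g x], with [s] the left end of a window and
    [g x] an offset. The index type is abstract, so that all blocks of an interval can share it. *)
Definition sols2 : {set (X * X) * (X * X)} :=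
  [set t | [&& t.1.1 \in B, t.1.2 \in B, t.2.1 \in B & t.2.2 \in B] &&
   (p %| (s + g t.1.1) * (s + g t.1.2) - (s + g t.2.1) * (s + g t.2.2))%Z].

Definition sols3 : {set (X * X * X) * (X * X * X)} :=
  [set t | [&& t.1.1.1 \in B, t.1.1.2 \in B, t.1.2 \in B,
               t.2.1.1 \in B, t.2.1.2 \in B & t.2.2 \in B] &&
   (p %| (s + g t.1.1.1) * (s + g t.1.1.2) * (s + g t.1.2)
       - (s + g t.2.1.1) * (s + g t.2.1.2) * (s + g t.2.2))%Z].

Lemma window_dvdz_eq x y : (H <= p)%N -> x \in B -> y \in B ->
  (p %| g x - g y)%Z -> x = y.
Proof.
move=> Hp xB yB pd; apply: g_inj => //; apply/eqP; rewrite -subr_eq0; apply/eqP.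
apply: dvdz_small_eq0 pd _; move: (g x) (g y) (g_window xB) (g_window yB) Hp.
by clear; lia.
Qed.

Lemma window_mul_dvdz_eq x y z : (H <= p)%N -> x \in B -> y \in B -> z \in B ->
  (p %| (s + g z) * (s + g x) - (s + g z) * (s + g y))%Z -> x = y.
Proof.
move=> Hp xB yB zB; rewrite -mulrBr Euclid_dvdzM // (negPf (B_unit zB)) /=.
by rewrite opprD addrACA subrr add0r; apply: window_dvdz_eq.
Qed.

(** Subtracting the two products leaves a linear polynomial [fa * Z + fb] that vanishes at [s]
    modulo [p]. As [H ^ 2 <= p], each value of [fa] leaves O(1) values of [fb]. Evaluation at - y1
    then fixes the integer (x1 - y1) (x2 - y1), and the divisor bound applies when it is nonzero. *)
Lemma card_sols2 : (0 < H)%N -> (H ^ 2 <= p)%N -> (#|sols2| <= 92 * (H ^ 2 * D))%N.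
Proof.
move=> H0 H2p.
have Hp : (H <= p)%N by rewrite (leq_trans _ H2p) // leq_pmulr.
have D1 : (1 <= D)%N.
  rewrite -(_ : size (divisors 1) = 1)%N //; apply: tauD => /=.
  by rewrite muln_gt0 expn_gt0 H0.
(* In [A1] and [A2] a unit cancels and the other two variables agree as well. *)
pose A1 := [set t in sols2 | t.1.1 == t.2.1].
pose A2 := [set t in sols2 | t.1.2 == t.2.1].
pose A3 := [set t in sols2 | (t.1.1 != t.2.1) && (t.1.2 != t.2.1)].
have cB := card_window.
have cBB : (#|setX B B| <= H ^ 2)%N by rewrite cardsX; exact: leq_mul.
have le1 : (#|A1| <= H ^ 2)%N.
  apply: leq_trans cBB; rewrite -[X in (_ <= X)%N]muln1.
  apply: (card_fibers_set (f := fun t => t.1)).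
    by case=> [[x1 x2] [y1 y2]]; rewrite !inE /= => /andP[/andP[/and4P[-> ->]]].
  case=> [[x1 x2] [y1 y2]] _; apply: card_le1_eq => -[[a1 a2] [b1 b2]] [[c1 c2] [d1 d2]].
  rewrite !inE /= => /andP[/andP[/andP[/and4P[a1B a2B b1B b2B] h1] /eqP E1] /eqP[F1 F2]].
  move=> /andP[/andP[/andP[/and4P[c1B c2B d1B d2B] h2] /eqP E2] /eqP[F3 F4]].
  suff <- : b2 = d2 by rewrite -E1 -E2 F1 F2 F3 F4.
  rewrite -E1 F1 F2 in h1; rewrite -E2 F3 F4 in h2; rewrite F1 in a1B.
  apply: (window_mul_dvdz_eq Hp b2B d2B a1B).
  by apply: dvdz_eqr (dvdzB h2 h1); ring.
have le2 : (#|A2| <= H ^ 2)%N.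
  apply: leq_trans cBB; rewrite -[X in (_ <= X)%N]muln1.
  apply: (card_fibers_set (f := fun t => t.1)).
    by case=> [[x1 x2] [y1 y2]]; rewrite !inE /= => /andP[/andP[/and4P[-> ->]]].
  case=> [[x1 x2] [y1 y2]] _; apply: card_le1_eq => -[[a1 a2] [b1 b2]] [[c1 c2] [d1 d2]].
  rewrite !inE /= => /andP[/andP[/andP[/and4P[a1B a2B b1B b2B] h1] /eqP E1] /eqP[F1 F2]].
  move=> /andP[/andP[/andP[/and4P[c1B c2B d1B d2B] h2] /eqP E2] /eqP[F3 F4]].
  suff <- : b2 = d2 by rewrite -E1 -E2 F1 F2 F3 F4.
  rewrite -E1 F1 F2 in h1; rewrite -E2 F3 F4 in h2; rewrite F2 in a2B.
  apply: (window_mul_dvdz_eq Hp b2B d2B a2B).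
  by apply: dvdz_eqr (dvdzB h2 h1); ring.
pose fa (t : (X * X) * (X * X)) := g t.1.1 + g t.1.2 - g t.2.1 - g t.2.2.
pose fb (t : (X * X) * (X * X)) := g t.1.1 * g t.1.2 - g t.2.1 * g t.2.2.
have le3 : (#|A3| <= 90 * (H ^ 2 * D))%N.
  (* The factors count the values of [fa], [fb], y1 and x1 - y1; they are at most 9 H, 5, H and 2
     D. *)
  suff: (#|A3| <= (2 * (4 * H %/ 1) + 1) * ((2 * (2 * H ^ 2 %/ p) + 1) * (H * (2 * D * 1))))%N.
    move=> h; apply: leq_trans h _; rewrite divn1.
    have q2 : (2 * H ^ 2 %/ p <= 2)%N by rewrite -ltnS ltn_divLR ?prime_gt0 //; have := prime_gt0 p_prime; lia.
    apply: (@leq_trans ((9 * H) * (5 * (H * (2 * D)))))%N; last by rewrite -mulnn; lia.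
    by rewrite !muln1; apply: leq_mul; [lia|apply: leq_mul => //; lia].
  apply: (card_fibers_modz (f := fa)) => //.
    move=> [[x1 x2] [y1 y2]] [[x3 x4] [y3 y4]]; rewrite /fa !inE /=.
    move=> /andP[/andP[/and4P[m1 m2 m3 m4] _] _] /andP[/andP[/and4P[m5 m6 m7 m8] _] _].
    have [h1 _] := window2_le (g_window m1) (g_window m2) (g_window m3) (g_window m4).
    have [h2 _] := window2_le (g_window m5) (g_window m6) (g_window m7) (g_window m8).
    by move: (leq_abszB h1 h2); rewrite mulnA.
  move=> t tA; apply: (card_fibers_modz (f := fb)); first exact: prime_gt0.
  - move=> [[x1 x2] [y1 y2]] [[x3 x4] [y3 y4]]; rewrite !inE /= => u v.
    have /andP[/andP[/andP[_ d1] _] /eqP e1] := u.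
    have /andP[/andP[/andP[_ d2] _] /eqP e2] := v.
    apply: dvdz_eqr (dvdzB d1 d2).
    rewrite (_ : _ - _ = fb ((x1, x2), (y1, y2)) - fb ((x3, x4), (y3, y4))
      + s * (fa ((x1, x2), (y1, y2)) - fa ((x3, x4), (y3, y4)))); last by rewrite /fa /fb /=; ring.
    by rewrite e1 e2 subrr mulr0 addr0.
  - move=> [[x1 x2] [y1 y2]] [[x3 x4] [y3 y4]]; rewrite /fb !inE /=.
    move=> /andP[/andP[/andP[/and4P[m1 m2 m3 m4] _] _] _].
    move=> /andP[/andP[/andP[/and4P[m5 m6 m7 m8] _] _] _].
    have [_ h1] := window2_le (g_window m1) (g_window m2) (g_window m3) (g_window m4).
    have [_ h2] := window2_le (g_window m5) (g_window m6) (g_window m7) (g_window m8).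
    exact: leq_abszB h1 h2.
  move=> t2 t2A; set A5 := [set _ in _ | _].
  apply: (@leq_trans (#|B| * (2 * D * 1))); last by rewrite leq_mul2r cB orbT.
  have A5P z : z \in A5 -> [/\ [/\ z.1.1 \in B, z.1.2 \in B, z.2.1 \in B & z.2.2 \in B],
      z.1.1 != z.2.1, z.1.2 != z.2.1, fa z = fa t & fb z = fb t2].
    rewrite !inE => /andP[/andP[/andP[/andP[/and4P[? ? ? ?] _] /andP[? ?]] /eqP ?] /eqP ?].
    by split.
  have key z : z \in A5 ->
      (g z.1.1 - g z.2.1) * (g z.1.2 - g z.2.1) = fb t2 - fa t * g z.2.1.
    by move=> /A5P[_ _ _ <- <-]; rewrite /fa /fb /=; ring.
  apply: (card_fibers_set (f := fun t => t.2.1)) => [z /A5P[[]] // |t3 t3A].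
  have nz : (g t3.1.1 - g t3.2.1) * (g t3.1.2 - g t3.2.1) != 0.
    have [[m1 m2 m3 m4] n1 n2 _ _] := A5P _ t3A.
    by rewrite mulf_eq0 negb_or !subr_eq0 !(inj_in_eq g_inj) // n1.
  apply: (@card_fibers_divisor _ (fun t => g t.1.1 - g t.2.1) _ (fb t2 - fa t * g t3.2.1)).
  - by rewrite -(key _ t3A).
  - apply: tauD; rewrite -(key _ t3A) absz_gt0 nz /= abszM.
    apply: (@leq_trans (H * H)); last first.
      by rewrite mulnn (@leq_trans (H ^ 6)) ?leq_pmull // leq_pexp2l.
    have [[m1 m2 m3 m4] _ _ _ _] := A5P _ t3A.
    by apply: leq_mul; apply: window_absz; apply: g_window.
  - by move=> z; rewrite inE => /andP[zA /eqP <-]; rewrite -key // dvdz_mulr.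
  move=> z zA; apply: card_le1_eq => u v.
  move=> /setIdP[/setIdP[uA /eqP u1] /eqP u2] /setIdP[/setIdP[vA /eqP v1] /eqP v2].
  have [[a1 a2 a3 a4] _ _ fua _] := A5P _ uA; have [[b1 b2 b3 b4] _ _ fva _] := A5P _ vA.
  have e21 : u.2.1 = v.2.1 by rewrite u1 v1.
  have g11 : g u.1.1 = g v.1.1.
    by move: u2; rewrite -v2 e21 => /(congr1 (fun w => w + g v.2.1)); rewrite !subrK.
  have g12 : g u.1.2 = g v.1.2.
    have := key _ uA; rewrite e21 -(key _ vA) g11 => /mulfI h.
    apply: (addIr (- g v.2.1)); apply: h.
    have [_ n1 _ _ _] := A5P _ vA.
    by rewrite subr_eq0 (inj_in_eq g_inj).
  have g22 : g u.2.2 = g v.2.2.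
    by move: fua; rewrite -fva /fa g11 g12 e21 => /addrI /oppr_inj.
  move: e21 (g_inj a1 b1 g11) (g_inj a2 b2 g12) (g_inj a4 b4 g22).
  by case: (u) => [[? ?] [? ?]]; case: (v) => [[? ?] [? ?]] /= -> -> -> ->.
have sub : sols2 \subset A1 :|: A2 :|: A3.
  apply/subsetP => t tS; apply/setUP; case: (boolP (t.1.1 == t.2.1)) => e1.
    by left; apply/setUP; left; apply/setIdP.
  case: (boolP (t.1.2 == t.2.1)) => e2; last by right; apply/setIdP; rewrite e1 e2.
  by left; apply/setUP; right; apply/setIdP.
apply: leq_trans (subset_leq_card sub) _.
have := (leq_card_setU (A1 :|: A2) A3).1; have := (leq_card_setU A1 A2).1.
have : (H ^ 2 <= H ^ 2 * D)%N by rewrite leq_pmulr.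
by lia.
Qed.
End Congruence.

(** * Quadratic polynomials with a root [s] modulo [p], and the lattice of the (u, v) with u s + v =
    0 modulo [p] *)

Lemma absz_dvdz (u z : int) : (`|u|%N%:Z %| z)%Z = (u %| z)%Z.
Proof. by rewrite !dvdzE absz_id. Qed.

Lemma leq_abszB_le (M M' : nat) (x y : int) : (2 * M <= M')%N ->
  (`|x| <= M)%N -> (`|y| <= M)%N -> (`|(x - y)%R| <= M')%N.
Proof. lia. Qed.

Lemma leq_absz_B (a b : nat) (x y : int) : (`|x| <= a)%N -> (`|y| <= b)%N ->
  (`|(x - y)%R| <= a + b)%N.
Proof. lia. Qed.

Lemma leq_absz_BD (a b c : nat) (x y z : int) : (`|x| <= a)%N -> (`|y| <= b)%N ->
  (`|z| <= c)%N -> (`|(x - y + z)%R| <= a + b + c)%N.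
Proof. lia. Qed.

Definition fibers_le (T : finType) (K : eqType) (f : T -> K) (A : {set T}) (m : nat) :=
  {in A, forall x, #|[set y in A | f y == f x]| <= m}%N.

(** On [A'] the map [f'] determines [f], so its fibres are smaller. This drops coordinates that are
    already fixed. *)
Lemma fibers_le_sub (T : finType) (K K' : eqType) (f : T -> K) (f' : T -> K')
    (A A' : {set T}) (m : nat) :
  A' \subset A -> {in A' &, forall x y, f' x = f' y -> f x = f y} ->
  fibers_le f A m -> fibers_le f' A' m.
Proof.
move=> /subsetP sA ff fm x xA; apply: leq_trans (fm x (sA x xA)).
apply/subset_leq_card/subsetP => y /setIdP[yA /eqP e]; apply/setIdP; split.
  exact: sA.
exact/eqP/ff.
Qed.

(** Since (u, v) is primitive, two points (a, b) differ by t (u, v) with t an integer, and the two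
    ranges bound |t| by M H / max(|u| H, |v|). The proof counts [a] in steps of |u| or [b] in steps
    of |v|, whichever term gives the maximum. *)
Lemma card_line (T : finType) (A : {set T}) (a b : T -> int) (u v : int) (H M m : nat) :
  (0 < H)%N -> coprimez u v ->
  {in A &, forall x y, (a x - a y) * v = (b x - b y) * u} ->
  {in A &, forall x y, `|a x - a y| <= M%:Z} ->
  {in A &, forall x y, `|b x - b y| <= (M * H)%N%:Z} ->
  fibers_le (fun x => (a x, b x)) A m ->
  (#|A| <= (2 * (M * H %/ maxn (`|u| * H) `|v|) + 1) * m)%N.
Proof.
move=> H0 cuv ab aM bM fm.
have [le|lt] := leqP `|v| (`|u| * H).
  have u0 : (0 < `|u|)%N.
    rewrite absz_gt0; apply: contraTneq cuv => u0; move: le.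
    by rewrite u0 mul0n leqn0 => /eqP v0; rewrite coprimezE v0.
  rewrite divnMr //; apply: (card_fibers_modz (f := a)) => //.
    move=> x y xA yA; rewrite absz_dvdz -(Gauss_dvdzl _ cuv) ab // dvdz_mull //.
  apply: fibers_le_sub (subxx _) _ fm => x y xA yA e; congr (_, _) => //.
  apply/eqP; rewrite -subr_eq0; have /eqP := ab x y xA yA.
  by rewrite e subrr mul0r eq_sym mulf_eq0 -[u == 0]absz_eq0 eqn0Ngt u0 orbF.
have v0 : (0 < `|v|)%N by rewrite (leq_ltn_trans _ lt).
apply: (card_fibers_modz (f := b)) => //.
  move=> x y xA yA; rewrite absz_dvdz -(@Gauss_dvdzl _ _ u); last by rewrite coprimez_sym.
  by rewrite -ab // dvdz_mull.
apply: fibers_le_sub (subxx _) _ fm => x y xA yA e; congr (_, _) => //.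
apply/eqP; rewrite -subr_eq0; have /eqP := ab x y xA yA.
by rewrite e subrr mul0r mulf_eq0 -[v == 0]absz_eq0 eqn0Ngt v0 orbF.
Qed.

(** The gcd of [u] and [v] is nonzero and below [p], so it can be divided out of the congruence. *)
Lemma primitive_solution (p : nat) (s u v : int) : prime p ->
  (u != 0) || (v != 0) -> (`|u| < p)%N -> (`|v| < p)%N -> (p %| u * s + v)%Z ->
  exists u' v', [/\ coprimez u' v', (p %| u' * s + v')%Z, (`|u'| <= `|u|)%N & (`|v'| <= `|v|)%N].
Proof.
move=> pp uv0 up vp puv; set g := gcdz u v.
have g0 : g != 0 by rewrite gcdz_eq0 negb_and.
have ga : `|g|%N%:Z = g by rewrite gez0_abs.
have eu := divzK (dvdz_gcdl u v); have ev := divzK (dvdz_gcdr u v).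
rewrite -/g in eu ev.
have gpos : (0 < `|g|)%N by rewrite absz_gt0.
exists (u %/ g)%Z, (v %/ g)%Z; split.
- rewrite /coprimez; apply/eqP/(mulIf g0); rewrite mul1r.
  transitivity (gcdz (u %/ g)%Z (v %/ g)%Z * `|g|%N%:Z); first by rewrite ga.
  by rewrite mulz_gcdl eu ev.
- move: puv; rewrite -{1}eu -{1}ev mulrAC -mulrDl Euclid_dvdzM //.
  case/orP => // /dvdz_small_eq0 gz; have := g0; rewrite gz ?eqxx //.
  have [u0|u0] := eqVneq u 0; first rewrite u0 eqxx /= in uv0.
    rewrite -abszE ltz_nat (leq_ltn_trans _ vp) //.
    by rewrite -{1}ev abszM leq_pmull // absz_gt0; apply: contraNneq uv0 => z; rewrite -ev z mul0r.
  rewrite -abszE ltz_nat (leq_ltn_trans _ up) //.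
  by rewrite -{1}eu abszM leq_pmull // absz_gt0; apply: contraNneq u0 => z; rewrite -eu z mul0r.
- by rewrite -{2}eu abszM leq_pmulr.
- by rewrite -{2}ev abszM leq_pmulr.
Qed.

Section Lattice.
Variables (p H : nat) (s : int).
Hypothesis p_prime : prime p.
Hypothesis H7 : (7 <= H)%N.
Hypothesis H4p : (H ^ 4 <= p)%N.

(** The ranges are those of the coefficients of a difference of two products of three factors Z + x
    with 0 <= x < H. *)
Definition small_quads (T : finType) (A : {set T}) (a2 a1 a0 : T -> int) :=
  {in A, forall x, [/\ (`|a2 x| <= 3 * H)%N, (`|a1 x| <= 3 * (H * H))%N,
    (`|a0 x| <= H * H * H)%N & (p %| a2 x * s ^+ 2 + a1 x * s + a0 x)%Z]}.

(* v^2 b2 - u v b1 + u^2 b0 is u^2 times the value of b2 Z^2 + b1 Z + b0 at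
   Z = - v / u, which is s modulo p. *)
Definition quad_value (u v b2 b1 b0 : int) := b2 * v ^+ 2 - b1 * (u * v) + b0 * u ^+ 2.

Lemma quad_value_le (Q : nat) (u v b2 b1 b0 : int) : (`|u| * H <= Q)%N -> (`|v| <= Q)%N ->
  (`|b2| <= 3 * H)%N -> (`|b1| <= 3 * (H * H))%N -> (`|b0| <= H * H * H)%N ->
  (`|quad_value u v b2 b1 b0| <= 7 * H * (Q * Q))%N.
Proof.
move=> uQ vQ x2 x1 x0.
have q2 : (`|(b2 * v ^+ 2)%R| <= 3 * H * (Q * Q))%N.
  by rewrite abszM leq_mul // expr2 abszM leq_mul.
have q1 : (`|(b1 * (u * v))%R| <= 3 * H * (Q * Q))%N.
  rewrite !abszM; apply: (@leq_trans (3 * (H * H) * (`|u| * `|v|))); first by rewrite leq_mul.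
  rewrite (_ : _ * _ = 3 * H * ((`|u| * H) * `|v|))%N; last by ring.
  by rewrite leq_mul // leq_mul.
have q0 : (`|(b0 * u ^+ 2)%R| <= H * (Q * Q))%N.
  rewrite expr2 !abszM; apply: (@leq_trans (H * H * H * (`|u| * `|u|))); first by rewrite leq_mul.
  rewrite (_ : _ * _ = H * ((`|u| * H) * (`|u| * H)))%N; last by ring.
  by rewrite leq_mul // leq_mul.
rewrite (_ : 7 * H * (Q * Q) = 3 * H * (Q * Q) + 3 * H * (Q * Q) + H * (Q * Q))%N.
  exact: leq_absz_BD.
by ring.
Qed.

Lemma quad_value_dvd (u v b2 b1 b0 : int) : (p %| u * s + v)%Z ->
  (p %| b2 * s ^+ 2 + b1 * s + b0)%Z -> (p %| quad_value u v b2 b1 b0)%Z.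
Proof.
move=> puv xp.
have := rpredD (dvdz_mulr (u ^+ 2) xp) (dvdz_mulr (b2 * (v - u * s) - b1 * u) puv).
by apply: dvdz_eqr; rewrite /quad_value; ring.
Qed.

(** Two polynomials with the same leading coefficient differ by a linear one, whose coefficients
    form a lattice vector in the excluded range. So [a2] determines the polynomial. *)
Lemma card_quads_no_short (T : finType) (A : {set T}) (a2 a1 a0 : T -> int) (m : nat) :
  (forall u v : int, (`|u| <= 6 * (H * H))%N -> (`|v| <= 6 * (H * H * H))%N ->
     (p %| u * s + v)%Z -> u = 0 /\ v = 0) ->
  small_quads A a2 a1 a0 -> fibers_le (fun x => (a2 x, a1 x, a0 x)) A m ->
  (#|A| <= (2 * (6 * H) + 1) * m)%N.
Proof.
move=> noshort sq fm; rewrite -[(6 * H)%N]divn1.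
apply: (card_fibers_modz (f := a2)) => //.
  by move=> x y /sq[h _ _ _] /sq[h' _ _ _]; have := leq_abszB h h'; rewrite mulnA.
apply: fibers_le_sub (subxx _) _ fm => x y xA yA e.
have [_ x1 x0 xp] := sq x xA; have [_ y1 y0 yp] := sq y yA.
have [|||E1 E0] := noshort (a1 x - a1 y) (a0 x - a0 y).
- by apply: leq_abszB_le x1 y1; rewrite ?mulnA !leq_mul2r !orbT.
- by apply: leq_abszB_le x0 y0; rewrite ?mulnA !leq_mul2r !orbT.
- by apply: dvdz_eqr (dvdzB xp yp); rewrite e; ring.
by rewrite e (subr0_eq E1) (subr0_eq E0).
Qed.

(** For fixed [a2] the differences of (a1, a0) lie in the lattice, which has determinant [p]. Hence
    [a1 * v - a0 * u] varies by multiples of [p], and each of its values leaves points on a line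
    with direction (u, v). *)
Lemma card_quads_medium (T : finType) (A : {set T}) (a2 a1 a0 : T -> int) (m Q : nat) (u v : int) :
  Q = maxn (`|u| * H) `|v| ->
  coprimez u v -> (p %| u * s + v)%Z ->
  small_quads A a2 a1 a0 -> fibers_le (fun x => (a2 x, a1 x, a0 x)) A m ->
  (#|A| <= (2 * (6 * H) + 1) * ((2 * (8 * (H * H) * Q %/ p) + 1) *
     ((2 * (6 * (H * H) * H %/ Q) + 1) * m)))%N.
Proof.
move=> eQ cuv puv sq fm.
have H0 : (0 < H)%N by apply: leq_trans H7.
rewrite -{1}[(6 * H)%N]divn1.
apply: (card_fibers_modz (f := a2)) => //.
  by move=> x y /sq[h _ _ _] /sq[h' _ _ _]; have := leq_abszB h h'; rewrite mulnA.
move=> z zA; apply: (card_fibers_modz (f := fun x => a1 x * v - a0 x * u)).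
- exact: prime_gt0.
- move=> x y /setIdP[xA /eqP x2] /setIdP[yA /eqP y2].
  have [_ x1 x0 xp] := sq x xA; have [_ y1 y0 yp] := sq y yA.
  have := rpredB (dvdz_mull (a1 x - a1 y) puv) (dvdz_mull u (dvdzB xp yp)).
  by apply: dvdz_eqr; rewrite x2 y2; ring.
- move=> x y /setIdP[xA _] /setIdP[yA _].
  have [_ x1 x0 xp] := sq x xA; have [_ y1 y0 yp] := sq y yA.
  rewrite -abszE lez_nat.
  have -> : a1 x * v - a0 x * u - (a1 y * v - a0 y * u) = (a1 x - a1 y) * v - (a0 x - a0 y) * u by ring.
  have q1 : (`|((a1 x - a1 y) * v)%R| <= 6 * (H * H) * Q)%N.
    by rewrite abszM eQ leq_mul ?leq_maxr //; apply: leq_abszB_le x1 y1; rewrite ?mulnA !leq_mul2r !orbT.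
  have q2 : (`|((a0 x - a0 y) * u)%R| <= 2 * (H * H) * Q)%N.
    rewrite abszM; apply: (@leq_trans (2 * (H * H * H) * `|u|)).
      by rewrite leq_mul //; apply: leq_abszB_le x0 y0; rewrite ?mulnA !leq_mul2r !orbT.
    by rewrite (_ : _ * _ = 2 * (H * H) * (`|u| * H))%N ?leq_mul ?eQ ?leq_maxl //; ring.
  rewrite (_ : 8 * (H * H) * Q = 6 * (H * H) * Q + 2 * (H * H) * Q)%N; last by ring.
  by apply: leq_absz_B.
move=> w wA; rewrite eQ; apply: (card_line (a := a1) (b := a0)) => //.
- move=> x y /setIdP[_ /eqP xw] /setIdP[_ /eqP yw].
  by apply/eqP; rewrite -subr_eq0 -[0](subrr (a1 w * v - a0 w * u)) -{1}xw -yw; apply/eqP; ring.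
- move=> x y /setIdP[/setIdP[/sq[_ h _ _] _] _] /setIdP[/setIdP[/sq[_ h' _ _] _] _].
  by move: (leq_abszB h h'); rewrite mulnA.
- move=> x y /setIdP[/setIdP[/sq[_ _ h _] _] _] /setIdP[/setIdP[/sq[_ _ h' _] _] _].
  by rewrite -abszE lez_nat; apply: leq_abszB_le h h'; rewrite ?mulnA !leq_mul2r !orbT.
apply: fibers_le_sub fm.
  by apply/subsetP => x /setIdP[/setIdP[]].
by move=> x y /setIdP[/setIdP[_ /eqP ->] _] /setIdP[/setIdP[_ /eqP ->] _] [-> ->].
Qed.

(** Here [quad_value] is a multiple of [p] of size O(H Q^2), so it takes few values. The difference
    of two polynomials with the same value has [quad_value] 0; by coprimality [u] divides its
    leading coefficient and [v] its constant one. Once one of these is fixed, the other two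
    coefficients lie on a line. *)
Lemma card_quads_short (T : finType) (A : {set T}) (a2 a1 a0 : T -> int) (m Q : nat) (u v : int) :
  Q = maxn (`|u| * H) `|v| ->
  coprimez u v -> (p %| u * s + v)%Z ->
  small_quads A a2 a1 a0 -> fibers_le (fun x => (a2 x, a1 x, a0 x)) A m ->
  (#|A| <= (2 * (14 * H * (Q * Q) %/ p) + 1) * ((2 * (6 * H * H %/ Q) + 1) *
     ((2 * (6 * (H * H) * H %/ Q) + 1) * m)))%N.
Proof.
move=> eQ cuv puv sq fm.
have H0 : (0 < H)%N by apply: leq_trans H7.
have uQ : (`|u| * H <= Q)%N by rewrite eQ leq_maxl.
have vQ : (`|v| <= Q)%N by rewrite eQ leq_maxr.
pose V x := quad_value u v (a2 x) (a1 x) (a0 x).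
have VQ x : x \in A -> (`|V x| <= 7 * H * (Q * Q))%N.
  by move=> /sq[x2 x1 x0 _]; apply: quad_value_le.
have Vp x : x \in A -> (p %| V x)%Z.
  by move=> /sq[_ _ _ xp]; apply: quad_value_dvd.
apply: (card_fibers_modz (f := V)).
- exact: prime_gt0.
- by move=> x y xA yA; apply: dvdzB; apply: Vp.
- by move=> x y /VQ h /VQ h'; rewrite -abszE lez_nat; apply: leq_abszB_le h h'; rewrite ?mulnA !leq_mul2r !orbT.
move=> z zA.
have Vdiff x y : x \in [set t in A | V t == V z] -> y \in [set t in A | V t == V z] ->
   (a2 x - a2 y) * v ^+ 2 - (a1 x - a1 y) * (u * v) + (a0 x - a0 y) * u ^+ 2 = 0.
  move=> /setIdP[_ /eqP xz] /setIdP[_ /eqP yz].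
  by have : V x - V y = 0 by [rewrite xz yz subrr]; rewrite /V /quad_value => <-; ring.
(* The coefficient fixed first is [a2], in steps of |u|, if |u| H is the maximum, and [a0], in steps
   of |v|, otherwise. *)
have [le|lt] := leqP `|v| (`|u| * H).
  have eQ' : Q = (`|u| * H)%N by rewrite eQ (maxn_idPl le).
  have u0 : (0 < `|u|)%N.
    rewrite absz_gt0; apply: contraTneq cuv => u0; move: le.
    by rewrite u0 mul0n leqn0 => /eqP v0; rewrite coprimezE v0.
  rewrite {1}eQ' divnMr //; apply: (card_fibers_modz (f := a2)) => //.
  + move=> x y xA yA; rewrite absz_dvdz -(@Gauss_dvdzl _ _ (v ^+ 2)) ?coprimezXr //.
    apply/dvdzP; exists ((a1 x - a1 y) * v - (a0 x - a0 y) * u).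
    by apply/eqP; rewrite -subr_eq0 -(Vdiff x y xA yA); apply/eqP; ring.
  + by move=> x y /setIdP[/sq[h _ _ _] _] /setIdP[/sq[h' _ _ _] _]; rewrite -abszE lez_nat; apply: leq_abszB_le h h'; rewrite ?mulnA !leq_mul2r !orbT.
  move=> w wA; rewrite eQ; apply: (card_line (a := a1) (b := a0)) => //.
  + move=> x y /setIdP[xA /eqP xw] /setIdP[yA /eqP yw].
    have := Vdiff x y xA yA; rewrite xw yw subrr mul0r add0r => h.
    have u0' : u != 0 by rewrite -absz_gt0.
    by apply: (mulfI u0'); apply/esym/eqP; rewrite -subr_eq0 -h; apply/eqP; ring.
  + move=> x y /setIdP[/setIdP[/sq[_ h _ _] _] _] /setIdP[/setIdP[/sq[_ h' _ _] _] _].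
    by move: (leq_abszB h h'); rewrite mulnA.
  + move=> x y /setIdP[/setIdP[/sq[_ _ h _] _] _] /setIdP[/setIdP[/sq[_ _ h' _] _] _].
    by rewrite -abszE lez_nat; apply: leq_abszB_le h h'; rewrite ?mulnA !leq_mul2r !orbT.
  apply: fibers_le_sub fm; first by apply/subsetP => x /setIdP[/setIdP[]].
  by move=> x y /setIdP[_ /eqP ->] /setIdP[_ /eqP ->] [-> ->].
have eQ' : Q = `|v|%N by rewrite eQ (maxn_idPr (ltnW lt)).
have v0 : (0 < `|v|)%N by rewrite (leq_ltn_trans _ lt).
rewrite mulnCA; apply: (@leq_trans ((2 * (6 * (H * H) * H %/ `|v|) + 1) * ((2 * (6 * H * H %/ maxn (`|u| * H) `|v|) + 1) * m))).
  apply: (card_fibers_modz (f := a0)) => //.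
  + move=> x y xA yA; rewrite absz_dvdz -(@Gauss_dvdzl _ _ (u ^+ 2)); last by rewrite coprimezXr // coprimez_sym.
    apply/dvdzP; exists ((a1 x - a1 y) * u - (a2 x - a2 y) * v).
    by apply/eqP; rewrite -subr_eq0 -(Vdiff x y xA yA); apply/eqP; ring.
  + by move=> x y /setIdP[/sq[_ _ h _] _] /setIdP[/sq[_ _ h' _] _]; rewrite -abszE lez_nat; apply: leq_abszB_le h h'; rewrite ?mulnA !leq_mul2r !orbT.
  move=> w wA; apply: (card_line (a := a2) (b := a1)) => //.
  + move=> x y /setIdP[xA /eqP xw] /setIdP[yA /eqP yw].
    have := Vdiff x y xA yA; rewrite xw yw subrr mul0r addr0 => h.
    have v0' : v != 0 by rewrite -absz_gt0.
    by apply: (mulfI v0'); apply/eqP; rewrite -subr_eq0 -h; apply/eqP; ring.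
  + move=> x y /setIdP[/setIdP[/sq[h _ _ _] _] _] /setIdP[/setIdP[/sq[h' _ _ _] _] _].
    by rewrite -abszE lez_nat; apply: leq_abszB_le h h'; rewrite ?mulnA !leq_mul2r !orbT.
  + move=> x y /setIdP[/setIdP[/sq[_ h _ _] _] _] /setIdP[/setIdP[/sq[_ h' _ _] _] _].
    by rewrite -abszE lez_nat; apply: leq_abszB_le h h'; rewrite ?mulnA !leq_mul2r !orbT.
  apply: fibers_le_sub fm; first by apply/subsetP => x /setIdP[/setIdP[]].
  by move=> x y /setIdP[_ /eqP ->] /setIdP[_ /eqP ->] [-> ->].
by rewrite -eQ -eQ'.
Qed.
End Lattice.

(** The two quotients are at most 8 Q / H^2 and 6 H^3 / Q, so [Q] cancels in their product; the
    range of [Q] makes each of them O(H). *)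
Lemma medium_count (H p Q : nat) : (0 < H)%N -> (H ^ 4 <= p)%N ->
  (H * H <= Q)%N -> (Q <= 6 * (H * H * H))%N ->
  ((2 * (6 * H) + 1) * ((2 * (8 * (H * H) * Q %/ p) + 1) *
     (2 * (6 * (H * H) * H %/ Q) + 1)) <= 35 * 169 * (H * H))%N.
Proof.
move=> H0 Hp HQ QH.
set w := (_ %/ p)%N; set y := (_ %/ Q)%N.
have wH : (w * (H * H) <= 8 * Q)%N.
  have h1 : (w * p <= 8 * (H * H) * Q)%N by apply: leq_divM.
  have h2 : (w * (H * H) * (H * H) <= 8 * Q * (H * H))%N.
    apply: leq_trans (_ : w * p <= _)%N; last by rewrite mulnAC.
    by rewrite -mulnA leq_mul2l -[(_ * _)%N](_ : H ^ 4 = _)%N ?Hp ?orbT //; lia.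
  by move: h2; rewrite leq_pmul2r ?muln_gt0 ?H0.
have yQ : (y * Q <= 6 * (H * H) * H)%N by apply: leq_divM.
have yH : (y <= 6 * H)%N.
  rewrite -(@leq_pmul2r (H * H)) ?muln_gt0 ?H0 //.
  by apply: leq_trans (leq_mul (leqnn _) HQ) _; rewrite (leq_trans yQ) //; lia.
have wH' : (w <= 48 * H)%N.
  by rewrite -(@leq_pmul2r (H * H)) ?muln_gt0 ?H0 //; lia.
have wy : (w * y <= 48 * H)%N.
  rewrite -(@leq_pmul2r (H * H)) ?muln_gt0 ?H0 // mulnAC.
  by apply: leq_trans (leq_mul wH (leqnn y)) _; lia.
apply: (@leq_trans ((13 * H) * (301 * H))); last by lia.
by apply: leq_mul; [lia|rewrite mulnDl mulnDr; lia].
Qed.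

(** The factors are at most 35 Q^2 / H^3, 13 H^2 / Q and 13 H^3 / Q. In the first, the summand 1 is
    absorbed by H^3 <= 7 Q^2, which follows from H^4 <= p <= 7 H Q^2. *)
Lemma short_count (H p Q : nat) : (0 < Q)%N -> (0 < H)%N -> (H ^ 4 <= p)%N ->
  (Q <= H * H)%N -> (p <= 7 * H * (Q * Q))%N ->
  ((2 * (14 * H * (Q * Q) %/ p) + 1) * ((2 * (6 * H * H %/ Q) + 1) *
     (2 * (6 * (H * H) * H %/ Q) + 1)) <= 35 * 169 * (H * H))%N.
Proof.
move=> Q0 H0 Hp HQ pQ.
set w := (_ %/ p)%N; set x := (_ %/ Q)%N; set y := (_ %/ Q)%N.
pose H3 := (H * H * H)%N.
have eH4 : (H ^ 4 = H * H3)%N by rewrite /H3; lia.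
rewrite eH4 in Hp.
have H30 : (0 < H3)%N by rewrite !muln_gt0 H0.
have hw : (w * H3 <= 14 * (Q * Q))%N.
  rewrite -(@leq_pmul2l H) //.
  have : (w * p <= 14 * H * (Q * Q))%N by apply: leq_divM.
  by have : (w * (H * H3) <= w * p)%N; [rewrite leq_mul2l Hp orbT|lia].
have h1 : (H3 <= 7 * (Q * Q))%N by rewrite -(@leq_pmul2l H) //; lia.
have w1 : ((2 * w + 1) * H3 <= 35 * (Q * Q))%N by lia.
have x1 : ((2 * x + 1) * Q <= 13 * (H * H))%N.
  by have : (x * Q <= 6 * H * H)%N; [apply: leq_divM|lia].
have y1 : ((2 * y + 1) * Q <= 13 * H3)%N.
  have : (y * Q <= 6 * (H * H) * H)%N by apply: leq_divM.
  have : (H * H <= H3)%N by rewrite leq_pmulr.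
  by rewrite /H3; lia.
have := leq_mul w1 (leq_mul x1 y1).
have -> : ((2 * w + 1) * H3 * ((2 * x + 1) * Q * ((2 * y + 1) * Q)) =
  ((2 * w + 1) * ((2 * x + 1) * (2 * y + 1))) * (H3 * (Q * Q)))%N by ring.
have -> : (35 * (Q * Q) * (13 * (H * H) * (13 * H3)) = (35 * 169 * (H * H)) * (H3 * (Q * Q)))%N by ring.
by rewrite leq_pmul2r // !muln_gt0 Q0 !H0.
Qed.

(** Three regimes, according to the size max(|u| H, |v|) of the smallest nonzero lattice vector: at
    most H^2, up to 6 H^3, or larger. Only the first has exceptional polynomials, those with
    [quad_value] 0. There the vector is chosen before [A], so that [A] may depend on it. *)
Lemma lattice_dichotomy (p H : nat) (s : int) : prime p -> (7 <= H)%N -> (H ^ 4 <= p)%N ->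
  (forall (T : finType) (A : {set T}) (a2 a1 a0 : T -> int) (m : nat),
     small_quads p H s A a2 a1 a0 -> fibers_le (fun x => (a2 x, a1 x, a0 x)) A m ->
     (#|A| <= 35 * 169 * (H * H) * m)%N) \/
  exists u v : int, [/\ coprimez u v, u != 0, (p %| u * s + v)%Z, (`|u| <= H)%N & (`|v| <= H * H)%N] /\
  (forall (T : finType) (A : {set T}) (a2 a1 a0 : T -> int) (m : nat),
     small_quads p H s A a2 a1 a0 -> fibers_le (fun x => (a2 x, a1 x, a0 x)) A m ->
     {in A, forall x, quad_value u v (a2 x) (a1 x) (a0 x) != 0} ->
     (#|A| <= 35 * 169 * (H * H) * m)%N).
Proof.
move=> pp H7 Hp.
have H0 : (0 < H)%N by apply: leq_trans H7.
have eH4 : (H ^ 4 = H * (H * H * H))%N by lia.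
(* By [7 <= H]. It keeps the entries of a medium vector below [p], as [primitive_solution]
   requires. *)
have lt6 : (6 * (H * H * H) < p)%N.
  apply: leq_trans Hp; rewrite eH4 -(prednK H0) ltn_pmul2r ?muln_gt0 //.
  by rewrite prednK.
case: (boolp.EM (exists u v : int, [/\ coprimez u v, (p %| u * s + v)%Z, (`|u| <= H)%N & (`|v| <= H * H)%N])).
  move=> [u [v [cuv puv uH vH]]]; right; exists u, v.
  have u0 : u != 0.
    apply/negP => /eqP u0; move: puv cuv; rewrite u0 mul0r add0r => pv.
    rewrite coprimezE /coprime gcd0n => v1.
    by move: pv; rewrite dvdzE (eqP v1) dvdn1 => /eqP /= p1; rewrite p1 in pp.
  split=> // T A a2 a1 a0 m sq fm nz.
  have [->|[z zA]] := set_0Vmem A; first by rewrite cards0.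
  pose Q := maxn (`|u| * H) `|v|.
  have Q0 : (0 < Q)%N by rewrite (leq_trans _ (leq_maxl _ _)) // muln_gt0 absz_gt0 u0.
  have QH : (Q <= H * H)%N by rewrite geq_max vH leq_mul2r uH orbT.
  (* [A] has an element, whose [quad_value] is a nonzero multiple of [p]. *)
  have pQ : (p <= 7 * H * (Q * Q))%N.
    have [z2 z1 z0 zp] := sq z zA.
    apply: leq_trans (quad_value_le (leq_maxl _ _) (leq_maxr _ _) z2 z1 z0).
    rewrite dvdn_leq ?absz_gt0 ?nz //.
    by have := quad_value_dvd puv zp; rewrite dvdzE.
  apply: leq_trans (card_quads_short pp H7 (erefl Q) cuv puv sq fm) _.
  by have := leq_mul (short_count Q0 H0 Hp QH pQ) (leqnn m); rewrite -!mulnA.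
move=> noshort; left => T A a2 a1 a0 m sq fm.
case: (boolp.EM (exists u v : int, [/\ (u != 0) || (v != 0), (p %| u * s + v)%Z,
    (`|u| <= 6 * (H * H))%N & (`|v| <= 6 * (H * H * H))%N])).
  move=> [u1 [v1 [uv0 puv1 uH1 vH1]]].
  have [u1p v1p] : (`|u1| < p)%N /\ (`|v1| < p)%N.
    split; [apply: leq_ltn_trans uH1 _|exact: leq_ltn_trans vH1 _].
    by apply: leq_ltn_trans lt6; rewrite leq_mul2l /= leq_pmulr.
  have [u [v [cuv puv uu vv]]] := primitive_solution pp uv0 u1p v1p puv1.
  pose Q := maxn (`|u| * H) `|v|.
  have QH : (Q <= 6 * (H * H * H))%N.
    rewrite geq_max (leq_trans vv vH1) andbT mulnA leq_mul2r.
    by rewrite (leq_trans uu uH1) orbT.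
  (* A smaller [Q] would give a vector excluded by [noshort]. *)
  have HQ : (H * H <= Q)%N.
    rewrite leqNgt; apply/negP => lt; apply: noshort; exists u, v; split=> //.
      by rewrite -(@leq_pmul2r H) // (leq_trans (leq_maxl _ `|v|)) // ltnW.
    by rewrite (leq_trans (leq_maxr (`|u| * H) _)) // ltnW.
  apply: leq_trans (card_quads_medium pp H7 (erefl Q) cuv puv sq fm) _.
  by have := leq_mul (medium_count H0 Hp HQ QH) (leqnn m); rewrite -!mulnA.
move=> nomed; apply: leq_trans (card_quads_no_short _ sq fm) _.
  move=> u v uH vH puv; have [u0|u0] := eqVneq u 0; have [v0|v0] := eqVneq v 0 => //.
  - by case: nomed; exists u, v; rewrite v0 orbT.
  - by case: nomed; exists u, v; rewrite u0.
  - by case: nomed; exists u, v; rewrite u0.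
rewrite leq_mul2r; apply/orP; right.
apply: (@leq_trans (13 * H)); first by lia.
by rewrite mulnA leq_mul2r (leq_trans _ (leq_pmulr _ H0)) ?orbT.
Qed.

(** * Congruences in three variables from a short interval *)

Lemma window3_quads (H : nat) (x1 x2 x3 y1 y2 y3 : int) :
  0 <= x1 < H%:Z -> 0 <= x2 < H%:Z -> 0 <= x3 < H%:Z ->
  0 <= y1 < H%:Z -> 0 <= y2 < H%:Z -> 0 <= y3 < H%:Z ->
  [/\ (`|(x1 + x2 + x3 - (y1 + y2 + y3))%R| <= 3 * H)%N,
      (`|(x1 * x2 + x1 * x3 + x2 * x3 - (y1 * y2 + y1 * y3 + y2 * y3))%R| <= 3 * (H * H))%N &
      (`|(x1 * x2 * x3 - y1 * y2 * y3)%R| <= H * H * H)%N].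
Proof.
move=> X1 X2 X3 Y1 Y2 Y3.
have two a b : 0 <= a < H%:Z -> 0 <= b < H%:Z -> 0 <= a * b <= (H * H)%N%:Z.
  move=> /andP[a0 aH] /andP[b0 bH]; rewrite mulr_ge0 //= PoszM.
  by apply: ler_pM => //; apply: ltW.
have three a b c : 0 <= a < H%:Z -> 0 <= b < H%:Z -> 0 <= c < H%:Z ->
    0 <= a * b * c <= (H * H * H)%N%:Z.
  move=> ha hb /andP[c0 cH]; have /andP[ab0 abH] := two _ _ ha hb.
  by rewrite mulr_ge0 //= PoszM; apply: ler_pM => //; apply: ltW.
(* The other two are differences of numbers from one interval, [0, 3 H^2] or [0, H^3], so no factor
   2 is lost. *)
split; first by lia.
  move: (two _ _ X1 X2) (two _ _ X1 X3) (two _ _ X2 X3) (two _ _ Y1 Y2) (two _ _ Y1 Y3) (two _ _ Y2 Y3).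
  move: (x1 * x2) (x1 * x3) (x2 * x3) (y1 * y2) (y1 * y3) (y2 * y3) (H * H)%N; clear; lia.
move: (three _ _ _ X1 X2 X3) (three _ _ _ Y1 Y2 Y3).
by move: (x1 * x2 * x3) (y1 * y2 * y3) (H * H * H)%N; clear; lia.
Qed.

Section Cubic.
Variables (X : finType) (g : X -> int) (B : {set X}) (H D p : nat) (s : int).
Hypothesis g_inj : {in B &, injective g}.
Hypothesis g_window : {in B, forall x, 0 <= g x < H%:Z}.
Hypothesis p_prime : prime p.
Hypothesis B_unit : {in B, forall x, ~~ (p %| s + g x)%Z}.
Hypothesis tauD : forall N, (0 < N <= 8 * H ^ 6)%N -> (size (divisors N) <= D)%N.
Hypothesis H0 : (0 < H)%N.
Hypothesis H4p : (H ^ 4 <= p)%N.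

Local Notation S3 := (sols3 g B p s).
Local Notation triple := (X * X * X)%type.

Let x1 (t : triple * triple) := g t.1.1.1.
Let x2 (t : triple * triple) := g t.1.1.2.
Let x3 (t : triple * triple) := g t.1.2.
Let y1 (t : triple * triple) := g t.2.1.1.
Let y2 (t : triple * triple) := g t.2.1.2.
Let y3 (t : triple * triple) := g t.2.2.

(** These are the coefficients of the product of the Z + x_i minus the product of the Z + y_i, where
    Z^3 cancels. *)
Definition sol3_e1 t := x1 t + x2 t + x3 t - (y1 t + y2 t + y3 t).
Definition sol3_e2 t := x1 t * x2 t + x1 t * x3 t + x2 t * x3 t -
  (y1 t * y2 t + y1 t * y3 t + y2 t * y3 t).
Definition sol3_e3 t := x1 t * x2 t * x3 t - y1 t * y2 t * y3 t.

Lemma sols3_mem t : t \in S3 ->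
  [/\ [/\ t.1.1.1 \in B, t.1.1.2 \in B & t.1.2 \in B],
      [/\ t.2.1.1 \in B, t.2.1.2 \in B & t.2.2 \in B] &
      (p %| sol3_e1 t * s ^+ 2 + sol3_e2 t * s + sol3_e3 t)%Z].
Proof.
rewrite inE => /andP[/and5P[h1 h2 h3 h4 /andP[h5 h6]] d]; split=> //.
by apply: dvdz_eqr d; rewrite /sol3_e1 /sol3_e2 /sol3_e3 /x1 /x2 /x3 /y1 /y2 /y3; ring.
Qed.

Lemma sols3_eq t t' : t \in S3 -> t' \in S3 -> x1 t = x1 t' -> x2 t = x2 t' -> x3 t = x3 t' ->
  y1 t = y1 t' -> y2 t = y2 t' -> y3 t = y3 t' -> t = t'.
Proof.
move=> /sols3_mem[[b1 b2 b3] [b4 b5 b6] _] /sols3_mem[[c1 c2 c3] [c4 c5 c6] _].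
move=> /(g_inj b1 c1) e1 /(g_inj b2 c2) e2 /(g_inj b3 c3) e3.
move=> /(g_inj b4 c4) e4 /(g_inj b5 c5) e5 /(g_inj b6 c6) e6.
case: t t' e1 e2 e3 e4 e5 e6 {b1 b2 b3 b4 b5 b6 c1 c2 c3 c4 c5 c6}.
by move=> [[? ?] ?] [[? ?] ?] [[[? ?] ?] [[? ?] ?]] /= -> -> -> -> -> ->.
Qed.

Lemma sols3_small (A : {set triple * triple}) : A \subset S3 ->
  small_quads p H s A sol3_e1 sol3_e2 sol3_e3.
Proof.
move=> /subsetP AS t /AS /sols3_mem[[b1 b2 b3] [b4 b5 b6] d].
have [h1 h2 h3] := window3_quads (g_window b1) (g_window b2) (g_window b3)
  (g_window b4) (g_window b5) (g_window b6).
by split.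
Qed.

(** [f] selects the variable x_i that equals y1, and [r] the other two. For each of the at most [H]
    values of [f], the unit s + y1 cancels and a solution in two variables remains. *)
Lemma card_sols3_cancel (f : triple * triple -> X) (r : triple * triple -> X * X) :
  (forall t, t \in S3 -> [/\ f t \in B, (r t).1 \in B, (r t).2 \in B &
     (s + x1 t) * (s + x2 t) * (s + x3 t) =
     (s + g (f t)) * ((s + g (r t).1) * (s + g (r t).2))]) ->
  {in S3 &, forall t t', f t = f t' -> r t = r t' -> t.1 = t'.1} ->
  (#|[set t in S3 | f t == t.2.1.1]| <= H * #|sols2 g B p s|)%N.
Proof.
move=> fP frI.
have cB := card_window g_inj g_window.
apply: (@leq_trans (#|B| * #|sols2 g B p s|)); last by rewrite leq_mul2r cB orbT.
apply: (card_fibers_set (f := f)) => [t /setIdP[/fP[]] // | t tA].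
set F := [set _ in _ | _].
have FP z : z \in F -> [/\ z \in S3, f z = z.2.1.1 & f z = f t].
  by case/setIdP => /setIdP[zS /eqP e1] /eqP e2.
pose phi (z : triple * triple) := (r z, (z.2.1.2, z.2.2)).
rewrite -(@card_in_imset _ _ phi F); last first.
  move=> z z' /FP[zS e1 e2] /FP[zS' e1' e2'] [er e3 e4].
  have e11 : z.1 = z'.1 by apply: frI; rewrite // e2 e2'.
  have e21 : z.2.1.1 = z'.2.1.1 by rewrite -e1 -e1' e2 e2'.
  move: e11 e21 e3 e4.
  by case: z {zS e1 e2 er} => [? [[? ?] ?]]; case: z' {zS' e1' e2'} => [? [[? ?] ?]] /= -> -> -> ->.
apply/subset_leq_card/subsetP => _ /imsetP[z zF ->].
have [zS e1 _] := FP z zF; have [fB r1B r2B ef] := fP z zS.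
have [_ [b4 b5 b6] _] := sols3_mem zS.
rewrite inE /= r1B r2B b5 b6 /=.
move: zS; rewrite inE => /andP[_]; rewrite -!/(x1 _) -!/(x2 _) -!/(x3 _) ef e1 -mulrA -mulrBr.
by rewrite Euclid_dvdzM // (negPf (B_unit b4)).
Qed.

(** Given the polynomial and y1, evaluation at - y1 fixes the nonzero product of the x_i - y1. Two
    of these factors are chosen among its divisors and the third follows; then y2 and y3 are known
    up to order, whence the last factor 2. *)
Lemma sols3_fibers (A : {set triple * triple}) : A \subset S3 ->
  {in A, forall t, [/\ x1 t != y1 t, x2 t != y1 t & x3 t != y1 t]} ->
  fibers_le (fun t => (sol3_e1 t, sol3_e2 t, sol3_e3 t)) A (H * ((2 * D) * ((2 * D) * (2 * 1)))).
Proof.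
move=> /subsetP AS ne t tA; set F := [set _ in _ | _].
have FA z : z \in F -> z \in A by case/setIdP.
have FS z : z \in F -> z \in S3 by move=> /FA/AS.
have Fe z : z \in F -> [/\ sol3_e1 z = sol3_e1 t, sol3_e2 z = sol3_e2 t & sol3_e3 z = sol3_e3 t].
  by case/setIdP => _ /eqP[-> -> ->].
have cB := card_window g_inj g_window.
apply: (@leq_trans (#|B| * ((2 * D) * ((2 * D) * (2 * 1))))); last by rewrite leq_mul2r cB orbT.
apply: (card_fibers_set (f := fun t => t.2.1.1)) => [z /FS/sols3_mem[_ []] // | t1 t1F].
pose N := sol3_e1 t * y1 t1 ^+ 2 - sol3_e2 t * y1 t1 + sol3_e3 t.
have eN z : z \in F -> y1 z = y1 t1 -> (x1 z - y1 z) * (x2 z - y1 z) * (x3 z - y1 z) = N.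
  by move=> /Fe[e1 e2 e3] ey; rewrite /N -ey -e1 -e2 -e3 /sol3_e1 /sol3_e2 /sol3_e3; ring.
have N0 : N != 0.
  rewrite -(eN _ t1F erefl) !mulf_eq0 !subr_eq0.
  by have [n1 n2 n3] := ne _ (FA _ t1F); rewrite (negPf n1) (negPf n2) (negPf n3).
have ND : (size (divisors `|N|) <= D)%N.
  apply: tauD; rewrite absz_gt0 N0 /= -(eN _ t1F erefl) !abszM.
  have [[b1 b2 b3] [b4 b5 b6] _] := sols3_mem (FS _ t1F).
  apply: (@leq_trans (H * H * H)).
    by rewrite !leq_mul // window_absz // g_window.
  by rewrite (@leq_trans (H ^ 6)) ?leq_pmull // !mulnn -expnSr leq_pexp2l.
apply: (card_fibers_divisor (f := fun z => x1 z - y1 z) N0 ND).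
  move=> z /setIdP[zF /eqP ez]; rewrite -(eN z zF) /y1 ?ez // -mulrA dvdz_mulr //.
move=> t2 t2F; apply: (card_fibers_divisor (f := fun z => x2 z - y1 z) N0 ND).
  move=> z /setIdP[/setIdP[zF /eqP ez] _]; rewrite -(eN z zF) /y1 ?ez // mulrAC.
  exact: dvdz_mull.
move=> t3 t3F; set G := [set _ in _ | _].
have ey2 : y1 t2 = y1 t1 by case/setIdP: t2F => _ /eqP e; rewrite /y1 e.
have ey3 : y1 t3 = y1 t1 by case/setIdP: t3F => /setIdP[_ /eqP e] _; rewrite /y1 e.
have GP z : z \in G -> [/\ z \in F, y1 z = y1 t1, x1 z = x1 t2 & x2 z = x2 t3].
  case/setIdP => /setIdP[/setIdP[zF /eqP e1] /eqP e2] /eqP e3.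
  have ez : y1 z = y1 t1 by rewrite /y1 e1.
  by split=> //; [move: e2; rewrite ez ey2 => /addIr|move: e3; rewrite ez ey3 => /addIr].
have GF z : z \in G -> z \in F by case/GP.
have x3E z z' : z \in G -> z' \in G -> x3 z = x3 z'.
  move=> zG zG'; have [zF zy zx1 zx2] := GP z zG; have [zF' zy' zx1' zx2'] := GP z' zG'.
  have := eN z' zF' zy'; rewrite -(eN z zF zy) zy zy' zx1 zx1' zx2 zx2'.
  have : x1 t2 - y1 t1 != 0 /\ x2 t3 - y1 t1 != 0.
    by rewrite -zy -zx1 -zx2 !subr_eq0; have [n1 n2 n3] := ne _ (FA _ zF).
  by case=> n1 n2 /(mulfI (mulf_neq0 n1 n2)) /addIr ->.
have [->|[t4 t4G]] := set_0Vmem G; first by rewrite cards0.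
have [t4F t4y t4x1 t4x2] := GP _ t4G.
(* The first two coefficients now give the sum and the product of y2 and y3. *)
have yE z : z \in G -> y2 z + y3 z = y2 t4 + y3 t4 /\ y2 z * y3 z = y2 t4 * y3 t4.
  move=> zG; have [zF zy zx1 zx2] := GP z zG; have zx3 := x3E z t4 zG t4G.
  have [e1 e2 _] := Fe z zF; have [f1 f2 _] := Fe t4 t4F.
  have h1 : y2 z + y3 z = y2 t4 + y3 t4.
    move: e1; rewrite -f1 /sol3_e1 zy t4y zx1 t4x1 zx2 t4x2 zx3 => /addrI /oppr_inj.
    by rewrite -!addrA => /addrI.
  split=> //; move: e2; rewrite -f2 /sol3_e2 zy t4y zx1 t4x1 zx2 t4x2 zx3 => /addrI /oppr_inj.
  by rewrite -!mulrDr h1 => /addrI.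
apply: (@card_fibers _ _ y2 _ [:: y2 t4; y3 t4]) => [z zG|z zG].
  have [h1 h2] := yE z zG; rewrite !inE -subr_eq0 -[_ == y3 t4]subr_eq0 -mulf_eq0; apply/eqP.
  have -> : (y2 z - y2 t4) * (y2 z - y3 t4) = y2 z ^+ 2 - y2 z * (y2 t4 + y3 t4) + y2 t4 * y3 t4 by ring.
  by rewrite -h1 -h2; ring.
apply: card_le1_eq => v w /setIdP[vG /eqP ev] /setIdP[wG /eqP ew].
have [vF vy vx1 vx2] := GP v vG; have [wF wy wx1 wx2] := GP w wG.
apply: sols3_eq; rewrite ?FS ?vy ?wy ?vx1 ?wx1 ?vx2 ?wx2 ?ev ?ew //; first exact: x3E.
by have [h1 _] := yE v vG; have [h2 _] := yE w wG; move: h1; rewrite -h2 ev ew => /addrI.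
Qed.

(** When [quad_value] is 0, the products of the u x_i - v and of the u y_i - v agree as integers.
    The factors are nonzero, being congruent to u (s + x) or u (s + y) modulo [p]. For given y_i,
    two divisors of a known integer determine the x_i. *)
Lemma card_sols3_degenerate (A : {set triple * triple}) (u v : int) : A \subset S3 ->
  u != 0 -> (p %| u * s + v)%Z -> (`|u| <= H)%N -> (`|v| <= H * H)%N ->
  {in A, forall t, quad_value u v (sol3_e1 t) (sol3_e2 t) (sol3_e3 t) = 0} ->
  (#|A| <= H * H * H * ((2 * D) * ((2 * D) * 1)))%N.
Proof.
move=> /subsetP AS u0 puv uH vH V0.
have cB := card_window g_inj g_window.
have Hp : (H < p)%N.
  have [H1|H1] := leqP H 1; first by apply: leq_ltn_trans H1 (prime_gt1 p_prime).
  by apply: leq_trans H4p; rewrite -{1}[H]expn1 ltn_exp2l.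
have up : (p %| u)%Z = false.
  apply/negP => /dvdz_small_eq0 h; move/eqP: u0; apply; apply: h.
  by rewrite -abszE ltz_nat (leq_ltn_trans uH).
have nz x : x \in B -> u * g x - v != 0.
  move=> xB; rewrite subr_eq0; apply/eqP => e; move: puv.
  by rewrite -e -mulrDr Euclid_dvdzM // up (negPf (B_unit xB)).
have le2 x : x \in B -> (`|(u * g x - v)%R| <= 2 * (H * H))%N.
  move=> xB; rewrite mul2n -addnn; apply: leq_absz_B => //.
  rewrite abszM leq_mul //; move: (g x) (g_window xB); clear; lia.
pose e t := (u * x1 t - v) * (u * x2 t - v) * (u * x3 t - v).
pose f t := (u * y1 t - v) * (u * y2 t - v) * (u * y3 t - v).
have ef t : t \in A -> e t = f t.
  move=> /V0 V; apply/eqP; rewrite -subr_eq0; apply/eqP.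
  by rewrite -[RHS](mulr0 u) -V /e /f /quad_value /sol3_e1 /sol3_e2 /sol3_e3; ring.
apply: (@leq_trans (#|setX (setX B B) B| * ((2 * D) * ((2 * D) * 1)))); last first.
  by rewrite leq_mul2r !cardsX !leq_mul ?orbT.
apply: (card_fibers_set (f := fun t => t.2)) => [z /AS/sols3_mem[_ []]|t tA].
  by rewrite !inE => -> -> ->.
have f0 : f t != 0.
  have [_ [b4 b5 b6] _] := sols3_mem (AS _ tA).
  by rewrite /f !mulf_neq0 ?nz.
have fD : (size (divisors `|f t|) <= D)%N.
  (* Three factors of size at most 2 H^2: this product accounts for the range 8 H^6 in [tauD]. *)
  apply: tauD; rewrite absz_gt0 f0 /=.
  have [_ [b4 b5 b6] _] := sols3_mem (AS _ tA).
  rewrite /f !abszM; apply: leq_trans (leq_mul (leq_mul (le2 _ b4) (le2 _ b5)) (le2 _ b6)) _.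
  by apply: eq_leq; ring.
have fe z : z \in A -> z.2 = t.2 -> e z = f t.
  by move=> zA e2; rewrite ef // /f /y1 /y2 /y3 e2.
apply: (card_fibers_divisor (f := fun z => u * x1 z - v) f0 fD).
  move=> z /setIdP[zF /eqP ez]; rewrite -(fe z zF ez) /e -mulrA dvdz_mulr //.
move=> t2 t2F; apply: (card_fibers_divisor (f := fun z => u * x2 z - v) f0 fD).
  move=> z /setIdP[/setIdP[zF /eqP ez] _]; rewrite -(fe z zF ez) /e mulrAC.
  exact: dvdz_mull.
move=> t3 t3F; apply: card_le1_eq => z w.
move=> /setIdP[/setIdP[/setIdP[zA /eqP z2] /eqP zx1] /eqP zx2].
move=> /setIdP[/setIdP[/setIdP[wA /eqP w2] /eqP wx1] /eqP wx2].
have inj a b : u * a - v = u * b - v -> a = b by move=> /addIr /(mulfI u0).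
apply: sols3_eq; rewrite ?AS // /y1 /y2 /y3 ?z2 ?w2 //.
- by apply: inj; rewrite zx1 wx1.
- by apply: inj; rewrite zx2 wx2.
have [[b1 b2 b3] _ _] := sols3_mem (AS _ zA).
have := fe _ wA w2; rewrite -(fe _ zA z2) /e zx1 wx1 zx2 wx2.
have n1 : u * x1 t2 - v != 0 by rewrite -zx1 nz.
have n2 : u * x2 t3 - v != 0 by rewrite -zx2 nz.
by move=> /(mulfI (mulf_neq0 n1 n2)) h; apply: inj.
Qed.

Lemma card_sols3 : (#|S3| <= 50 * (1000 * (H ^ 3 * D ^ 2)))%N.
Proof.
have D1 : (1 <= D)%N.
  rewrite -(_ : size (divisors 1) = 1)%N //; apply: tauD => /=.
  by rewrite muln_gt0 expn_gt0 H0.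
have cB := card_window g_inj g_window.
have DD : (D <= D ^ 2)%N by rewrite -mulnn leq_pmulr.
(* For H <= 6 the trivial count H^6 <= 216 H^3 suffices; the lattice count assumes [7 <= H]. *)
have [H6|H7] := leqP H 6.
  have : (#|S3| <= H ^ 3 * 216)%N.
    apply: (@leq_trans (#|setX (setX (setX B B) B) (setX (setX B B) B)|)).
      apply/subset_leq_card/subsetP => -[[[a1 a2] a3] [[b1 b2] b3]].
      by move=> /sols3_mem[[/= h1 h2 h3] [h4 h5 h6] _]; rewrite !inE /= h1 h2 h3 h4 h5 h6.
    rewrite !cardsX; apply: (@leq_trans ((H * H * H) * (H * H * H))); first by rewrite !leq_mul.
    apply: leq_mul; first by rewrite !expnS expn0 muln1 mulnA.
    by apply: (@leq_trans (6 * 6 * 6)); rewrite // !leq_mul.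
  by have : (H ^ 3 <= H ^ 3 * D ^ 2)%N; [rewrite leq_pmulr // expn_gt0 D1|lia].
pose Z := [set t in S3 | [&& x1 t != y1 t, x2 t != y1 t & x3 t != y1 t]].
pose Z1 := [set t in S3 | t.1.1.1 == t.2.1.1].
pose Z2 := [set t in S3 | t.1.1.2 == t.2.1.1].
pose Z3 := [set t in S3 | t.1.2 == t.2.1.1].
have c2 := card_sols2 g_inj g_window p_prime B_unit tauD H0 (leq_trans (leq_pexp2l H0 _) H4p).
have {}c2 : (#|sols2 g B p s| <= 92 * (H ^ 2 * D))%N by apply: c2.
have le1 : (#|Z1| <= H * #|sols2 g B p s|)%N.
  apply: (card_sols3_cancel (r := fun t => (t.1.1.2, t.1.2))) => [t /sols3_mem[[? ? ?] _ _]|t t' _ _].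
    by split=> //; rewrite mulrA.
  by case: t t' => [[[? ?] ?] ?] [[[? ?] ?] ?] /= -> [-> ->].
have le2 : (#|Z2| <= H * #|sols2 g B p s|)%N.
  apply: (card_sols3_cancel (r := fun t => (t.1.1.1, t.1.2))) => [t /sols3_mem[[? ? ?] _ _]|t t' _ _].
    by split=> //; rewrite /x1 /x2 /x3 /=; ring.
  by case: t t' => [[[? ?] ?] ?] [[[? ?] ?] ?] /= -> [-> ->].
have le3 : (#|Z3| <= H * #|sols2 g B p s|)%N.
  apply: (card_sols3_cancel (r := fun t => (t.1.1.1, t.1.1.2))) => [t /sols3_mem[[? ? ?] _ _]|t t' _ _].
    by split=> //; rewrite /x1 /x2 /x3 /=; ring.
  by case: t t' => [[[? ?] ?] ?] [[[? ?] ?] ?] /= -> [-> ->].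
have ZS : Z \subset S3 by apply/subsetP => t /setIdP[].
have Zne : {in Z, forall t, [/\ x1 t != y1 t, x2 t != y1 t & x3 t != y1 t]}.
  by move=> t /setIdP[_ /and3P[]].
pose m := (H * ((2 * D) * ((2 * D) * (2 * 1))))%N.
have leZ : (#|Z| <= 35 * 169 * (H * H) * m + H * H * H * ((2 * D) * ((2 * D) * 1)))%N.
  case: (lattice_dichotomy s p_prime H7 H4p) => [big|[u [v [[_ u0 puv uH vH] big]]]].
    apply: leq_trans (leq_addr _ _).
    by apply: big (sols3_small ZS) (sols3_fibers ZS Zne).
  (* Nonzero values are counted by the lattice, the value 0 by divisors. *)
  pose V t := quad_value u v (sol3_e1 t) (sol3_e2 t) (sol3_e3 t).
  pose Zn := [set t in Z | V t != 0]; pose Zz := [set t in Z | V t == 0].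
  have sub : Z \subset Zn :|: Zz.
    apply/subsetP => t tZ; apply/setUP; case: (boolP (V t == 0)) => h; [right|left];
    by apply/setIdP.
  apply: leq_trans (subset_leq_card sub) _; apply: leq_trans (leq_card_setU _ _).1 _.
  have ZnS : Zn \subset S3 by apply/subsetP => t /setIdP[/(subsetP ZS)].
  have ZzS : Zz \subset S3 by apply/subsetP => t /setIdP[/(subsetP ZS)].
  apply: leq_add; last first.
    by apply: (card_sols3_degenerate ZzS u0 puv uH vH) => t /setIdP[_ /eqP].
  apply: big (sols3_small ZnS) _ _; last by move=> t /setIdP[].
  by apply: sols3_fibers => // t /setIdP[/Zne].
have sub : S3 \subset Z :|: Z1 :|: Z2 :|: Z3.
  apply/subsetP => t tS; have [[b1 b2 b3] [b4 _ _] _] := sols3_mem tS.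
  have E x : x \in B -> (g x == y1 t) = (x == t.2.1.1) by move=> xB; apply: (inj_in_eq g_inj).
  case: (boolP (t.1.1.1 == t.2.1.1)) => h1.
    by apply/setUP; left; apply/setUP; left; apply/setUP; right; apply/setIdP.
  case: (boolP (t.1.1.2 == t.2.1.1)) => h2.
    by apply/setUP; left; apply/setUP; right; apply/setIdP.
  case: (boolP (t.1.2 == t.2.1.1)) => h3.
    by apply/setUP; right; apply/setIdP.
  apply/setUP; left; apply/setUP; left; apply/setUP; left; apply/setIdP; split=> //.
  by rewrite /x1 /x2 /x3 !E // h1 h2 h3.
apply: leq_trans (subset_leq_card sub) _; apply: leq_trans (leq_card_setU _ _).1 _.
have u1 := (leq_card_setU Z Z1).1; have u2 := (leq_card_setU (Z :|: Z1) Z2).1.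
have : (H * #|sols2 g B p s| <= 92 * (H ^ 3 * D ^ 2))%N.
  apply: (@leq_trans (H * (92 * (H ^ 2 * D)))); first by rewrite leq_mul2l c2 orbT.
  by rewrite mulnCA leq_mul2l /= mulnA -expnS leq_mul.
(* With 3 * 92 from the three cancelling cases the constant becomes 47600, below 50 * 1000. *)
have eZ : (35 * 169 * (H * H) * m + H * H * H * ((2 * D) * ((2 * D) * 1)) =
  (8 * (35 * 169) + 4) * (H ^ 3 * D ^ 2))%N by rewrite /m; ring.
rewrite eZ in leZ; move: (H ^ 3 * D ^ 2)%N leZ le1 le2 le3 u1 u2 => K.
move: #|Z| #|Z1| #|Z2| #|Z3| #|Z :|: Z1| #|Z :|: Z1 :|: Z2| (H * #|_|)%N.
by clear; lia.
Qed.

End Cubic.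

(** * Multiplicative energies in a finite field *)

Definition energy (F : finFieldType) (Y : finType) (S : {set Y}) (a : Y -> F) : nat :=
  #|[set t : Y * Y | [&& t.1 \in S, t.2 \in S & a t.1 == a t.2]]|.

Definition box (I X : finType) (B : I -> {set X}) : {set {ffun I -> X}} :=
  [set u : {ffun I -> X} | [forall i, u i \in B i]].

Definition prod_map (F : finFieldType) (I X : finType) (w : I -> X -> F)
  (u : {ffun I -> X}) : F := \prod_i w i (u i).

Lemma box_prod_map_neq0 (F : finFieldType) (I X : finType) (w : I -> X -> F)
    (B : I -> {set X}) :
  (forall i, {in B i, forall x, w i x != 0}) ->
  {in box B, forall u, prod_map w u != 0}.
Proof.
move=> w0 u; rewrite inE => /forallP uB.
by apply/prodf_neq0 => i _; apply: w0.
Qed.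

(** The irreducible characters of the abelian group of units, extended by 0. They only serve to
    count solutions, so their values in [algC] need no relation to those of [chi]. *)
Lemma unit_characters (F : finFieldType) : exists (K : finType) (c : K -> F -> algC),
  [/\ (0 < #|K|)%N, forall k, c k 1 = 1, forall k, {morph c k : x y / x * y} &
   forall a b, a != 0 -> b != 0 ->
     \sum_k c k a * (c k b)^* = (#|K| * (a == b))%:R].
Proof.
pose G := [set: {unit F}]%G.
have abG : abelian G.
  apply/centsP => x _ y _; rewrite /commute; apply/val_inj.
  by rewrite !FinRing.val_unitM mulrC.
have lin k : 'chi[G]_k \is a linear_char by apply/char_abelianP.
pose un (x : F) : {unit F} := insubd (1%g : {unit F}) x.
have unE x : x != 0 -> val (un x) = x by move=> x0; rewrite insubdK // unitfE.
pose c (k : Iirr G) (x : F) : algC := if x == 0 then 0 else 'chi_k (un x).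
exists (Iirr G), c; split.
- by apply/card_gt0P; exists 0.
- move=> k; rewrite /c oner_eq0 (_ : un 1 = 1%g) ?lin_char1 //.
  by apply/val_inj; rewrite unE ?oner_eq0.
- move=> k x y; rewrite /c mulf_eq0.
  have [->|x0] := eqVneq x 0; first by rewrite /= mul0r.
  have [->|y0] := eqVneq y 0; first by rewrite orbT /= mulr0.
  have -> : un (x * y) = (un x * un y)%g.
    by apply/val_inj; rewrite FinRing.val_unitM (unE x) // (unE y) // unE ?mulf_neq0.
  by rewrite /= lin_charM ?inE.
move=> a b a0 b0.
under eq_bigr do rewrite /c (negPf a0) (negPf b0).
rewrite second_orthogonality_relation ?inE // card_Iirr_abelian //.
rewrite (abelian_classP _ abG) ?inE // -[un a == un b](inj_eq val_inj) !unE //.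
rewrite -mulr_natl -natrM mulnC; congr (_ %:R); congr (_ * _)%N.
congr #|pred_of_set _|; apply/setIidPl.
by rewrite sub_cent1; apply/(subsetP abG); rewrite inE.
Qed.

(** Parseval: expand the squares and sum over [k] first. *)
Lemma energy_norm (F : finFieldType) (Y : finType) (S : {set Y}) (a : Y -> F)
    (K : finType) (c : K -> F -> algC) :
  (forall a b, a != 0 -> b != 0 -> \sum_k c k a * (c k b)^* = (#|K| * (a == b))%:R) ->
  {in S, forall u, a u != 0} ->
  (#|K| * energy S a)%:R = \sum_k `|\sum_(u in S) c k (a u)| ^+ 2.
Proof.
move=> orth a0.
under eq_bigr do rewrite normCK rmorph_sum big_distrlr /=.
rewrite exchange_big /=.
under eq_bigr do rewrite exchange_big /=.
transitivity (\sum_(u in S) \sum_(v in S) (#|K| * (a u == a v))%:R : algC); last first.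
  by apply: eq_bigr => u uS; apply: eq_bigr => v vS; rewrite orth ?a0.
rewrite /energy -[#|[set _ | _]|]sum1_card big_distrr /= natr_sum pair_big_dep /=.
rewrite big_mkcond [RHS]big_mkcond; apply: eq_bigr => -[u v] _ /=.
rewrite inE /=; case: (u \in S) (v \in S) (a u == a v) => [] [] [] //=.
by rewrite muln0.
Qed.

Lemma prodr_constT (R : pzSemiRingType) (I : finType) (x : R) :
  \prod_(i : I) x = x ^+ #|I|.
Proof. by rewrite -prodr_const; apply: eq_bigl. Qed.

(** The product is at most a power of its largest factor, which exists because nonnegative elements
    are comparable. *)
Lemma prod_le_sum_pow (R : numDomainType) (I : finType) (a : I -> R) :
  (0 < #|I|)%N -> (forall i, 0 <= a i) -> \prod_i a i <= \sum_i a i ^+ #|I|.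
Proof.
move=> I0 a0.
have [m mmax] : exists m, forall i, a i <= a m.
  have [i0 _] := card_gt0P I0.
  have : exists m, {in enum I, forall i, a i <= a m}.
    elim: (enum I) => [|x s [m mP]]; first by exists i0.
    have [le|le] : a x <= a m \/ a m <= a x.
      by apply/orP; apply: real_leVge; apply: ger0_real.
    - by exists m => i; rewrite inE => /orP[/eqP ->|/mP].
    - exists x => i; rewrite inE => /orP[/eqP ->//|/mP h]; exact: le_trans h le.
  by case=> m mP; exists m => i; apply: mP; rewrite mem_enum.
apply: (@le_trans _ _ (a m ^+ #|I|)).
  rewrite -prodr_constT; apply: ler_prod => i _.
  by rewrite a0 mmax.
by rewrite (bigD1 m) //= lerDl sumr_ge0 // => i _; rewrite exprn_ge0.
Qed.

(* Expanding both sides over the characters of the unit group, the left side is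
   the mean of a product over i of moduli and each term on the right is the mean
   of the corresponding power. *)
Lemma energy_box_le (F : finFieldType) (I X : finType) (w : I -> X -> F)
    (B : I -> {set X}) :
  (0 < #|I|)%N -> (forall i, {in B i, forall x, w i x != 0}) ->
  (energy (box B) (prod_map w) <=
   \sum_i energy (box (fun _ : I => B i)) (prod_map (fun _ : I => w i)))%N.
Proof.
move=> I0 w0; have [K [c [K0 c1 cM orth]]] := unit_characters F.
have sumE (w' : I -> X -> F) (B' : I -> {set X}) k :
    \sum_(u in box B') c k (prod_map w' u) = \prod_i \sum_(x in B' i) c k (w' i x).
  rewrite bigA_distr_big_dep; apply: eq_big => [u|u _].
    by rewrite inE; apply/forallP/familyP.
  by rewrite /prod_map (big_morph (c k) (cM k) (c1 k)).
rewrite -(leq_pmul2l K0) -(ler_nat algC) (energy_norm orth); last exact: box_prod_map_neq0.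
rewrite big_distrr natr_sum /=.
under [leRHS]eq_bigr => i _ do rewrite (energy_norm orth (box_prod_map_neq0 (fun _ => w0 i))).
rewrite exchange_big; apply: ler_sum => k _.
rewrite sumE normr_prod -prodrXl.
apply: le_trans (prod_le_sum_pow I0 _) _ => [i|]; first by rewrite exprn_ge0.
apply: ler_sum => i _; by rewrite sumE normr_prod prodr_constT -!exprM mulnC.
Qed.

Lemma card_dilate_pairs (F : finFieldType) (Y : finType) (S : {set Y}) (a : Y -> F) (z : F) :
  #|[set t : Y * Y | [&& t.1 \in S, t.2 \in S & a t.2 == z * a t.1]]| =
  (\sum_h #|[set u in S | a u == (z * h)%R]| * #|[set u in S | a u == h]|)%N.
Proof.
rewrite -sum1_card (eq_bigl (fun t : Y * Y => (t.1 \in S) && ((t.2 \in S) && (a t.2 == z * a t.1)))); last first.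
  by move=> t; rewrite inE.
rewrite -(pair_big_dep (fun u => u \in S) (fun u v => (v \in S) && (a v == z * a u)) (fun _ _ => 1%N)) /=.
rewrite (partition_big a predT) //=; apply: eq_bigr => h _.
rewrite -[#|[set u in S | a u == h]|]sum1_card big_distrr /=.
apply: eq_big => [u|u /andP[_ /eqP ->]]; first by rewrite inE.
by rewrite muln1 -sum1_card; apply: eq_bigl => v; rewrite inE.
Qed.

Lemma energyE (F : finFieldType) (Y : finType) (S : {set Y}) (a : Y -> F) :
  energy S a = (\sum_h #|[set u in S | a u == h]| ^ 2)%N.
Proof.
under eq_bigr => h _ do rewrite -mulnn -{1}[h]mul1r.
rewrite -card_dilate_pairs /energy; apply: eq_card => t.
by rewrite !inE mul1r [a t.2 == _]eq_sym.
Qed.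

(** With r(h) the number of representations of h, 2 r(z h) r(h) <= r(z h)^2 + r(h)^2, and
    multiplication by [z] permutes the field. *)
Lemma energy_dilate (F : finFieldType) (Y : finType) (S : {set Y}) (a : Y -> F) (z : F) :
  z != 0 ->
  (#|[set t : Y * Y | [&& t.1 \in S, t.2 \in S & a t.2 == (z * a t.1)%R]]| <= energy S a)%N.
Proof.
move=> z0; rewrite card_dilate_pairs energyE.
set r := fun h => #|[set u in S | a u == h]|; rewrite -(@leq_pmul2l 2) // big_distrr /=.
apply: (@leq_trans (\sum_h (r (z * h)%R ^ 2 + r h ^ 2))).
  by apply: leq_sum => h _; apply: (nat_Cauchy _ _).1.
rewrite big_split /= mul2n -addnn leq_add2r.
by rewrite [leqRHS](reindex (fun h => z * h)) //; exists (fun h => z^-1 * h) => h _; rewrite ?mulKf ?mulVKf.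
Qed.

(** Equal [e]-th powers have as ratio a root of unity of order dividing |e|. There are at most |e|
    such ratios, and each contributes the solutions of a dilated equation. *)
Lemma energy_exp_le (F : finFieldType) (Y : finType) (S : {set Y}) (a : Y -> F) (e : int) :
  e != 0 -> {in S, forall u, a u != 0} ->
  (energy S (fun u => (a u ^ e)%R) <= `|e| * energy S a)%N.
Proof.
move=> e0 a0; pose s := [seq z <- enum F | z ^+ `|e|%N == 1].
have eN0 : (0 < `|e|)%N by rewrite absz_gt0.
have ss : (size s <= `|e|)%N.
  rewrite -ltnS -(size_XnsubC (1 : F) eN0); apply: max_poly_roots.
  - by rewrite -size_poly_eq0 size_XnsubC.
  - by apply/allP => z; rewrite mem_filter rootE !hornerE subr_eq0 => /andP[].
  - by rewrite filter_uniq ?enum_uniq.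
apply: (@leq_trans (size s * energy S a)); last by rewrite leq_mul2r ss orbT.
apply: (card_fibers (f := fun t => a t.2 / a t.1)) => -[u v]; rewrite inE /= => /and3P[uS vS /eqP auv].
  rewrite mem_filter mem_enum andbT.
  have : (a v / a u) ^ e = 1 by rewrite expfzMl exprz_inv -invr_expz -auv mulfV // expfz_neq0 ?a0.
  by case: (e) => n /eqP //=; rewrite /exprz invr_eq1.
apply: leq_trans (energy_dilate S a (_ : a v / a u != 0)); last first.
  by rewrite mulf_neq0 ?invr_neq0 ?a0.
apply/subset_leq_card/subsetP => -[u' v']; rewrite !inE /= => /andP[/and3P[uS' vS' _] /eqP <-].
by rewrite uS' vS' divfK ?a0 ?eqxx.
Qed.

Lemma prod_map_exp (F : finFieldType) (I X : finType) (w : I -> X -> F) (e : int) u :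
  prod_map (fun i x => w i x ^ e) u = prod_map w u ^ e.
Proof.
by rewrite /prod_map (big_morph (fun x => x ^ e) (fun x y => expfzMl x y e) (exp1rz _ e)).
Qed.

(** Once both first coordinates are fixed, the equation in the remaining variables is a dilated
    one. *)
Lemma energyS (F : finFieldType) (X : finType) (n : nat) (w : X -> F) (B : {set X}) :
  {in B, forall x, w x != 0} ->
  (energy (box (fun _ : 'I_n.+1 => B)) (prod_map (fun _ : 'I_n.+1 => w)) <=
   #|B| ^ 2 * energy (box (fun _ : 'I_n => B)) (prod_map (fun _ : 'I_n => w)))%N.
Proof.
move=> w0; rewrite -mulnn -cardsX.
apply: (card_fibers_set (f := fun t : {ffun 'I_n.+1 -> X} * {ffun 'I_n.+1 -> X} => (t.1 ord0, t.2 ord0))) => [[u v]|[u v]].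
  by rewrite !inE /= => /and3P[/forallP -> /forallP -> _].
rewrite inE /= => /and3P[uS vS _].
have u0 : w (u ord0) != 0 by apply: w0; move: uS; rewrite inE => /forallP.
have v0 : w (v ord0) != 0 by apply: w0; move: vS; rewrite inE => /forallP.
set T := [set _ in _ | _].
pose tl (u : {ffun 'I_n.+1 -> X}) := [ffun i : 'I_n => u (lift ord0 i)].
have tlE (u1 u2 : {ffun 'I_n.+1 -> X}) : u1 ord0 = u2 ord0 -> tl u1 = tl u2 -> u1 = u2.
  move=> e0 /ffunP et; apply/ffunP => i; case: (unliftP ord0 i) => [j|] -> //.
  by have := et j; rewrite !ffunE.
rewrite -(@card_in_imset _ _ (fun t => (tl t.1, tl t.2)) T); last first.
  move=> [u1 v1] [u2 v2] /setIdP[_ /eqP[e1 e2]] /setIdP[_ /eqP[e3 e4]] [f1 f2].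
  by congr (_, _); apply: tlE; rewrite ?e1 ?e2 ?e3 ?e4.
apply: leq_trans (energy_dilate _ _ (_ : w (u ord0) / w (v ord0) != 0)); last first.
  by rewrite mulf_neq0 ?invr_neq0.
apply/subset_leq_card/subsetP => y /imsetP[[u1 v1] /setIdP[]].
rewrite !inE /= => /and3P[/forallP u1B /forallP v1B /eqP e1] /eqP[eu ev] -> /=.
apply/and3P; split; try by apply/forallP => i; rewrite ffunE.
move: e1; rewrite /prod_map !big_ord_recl eu ev => e1.
apply/eqP; apply: (mulfI v0); rewrite mulrA mulrCA mulfV // mulr1.
under eq_bigr do rewrite ffunE; under [in RHS]eq_bigr do rewrite ffunE.
by rewrite -e1.
Qed.

(** * Energies of short intervals modulo [p] *)

Lemma intr_Fp_eq0 (p : nat) (z : int) : prime p -> ((z%:~R : 'F_p) == 0) = (p %| z)%Z.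
Proof. by move=> pp; rewrite (dvdz_pcharf (pchar_Fp pp)). Qed.

(* If H^(window_exp nu) <= p, the energy of nu variables in a window of length H
   is at most H^(energy_exp nu) up to divisor functions; the exponent 5 for
   nu = 4 is not optimal. *)
Definition window_exp (nu : nat) : nat := if nu == 2 then 2 else 4.

Definition energy_exp (nu : nat) : nat := nu + (nu == 4).

Section WindowEnergy.
Variables (X : finType) (g : X -> int) (B : {set X}) (H D p : nat) (s : int).
Hypothesis g_inj : {in B &, injective g}.
Hypothesis g_window : {in B, forall x, 0 <= g x < H%:Z}.
Hypothesis p_prime : prime p.
Hypothesis B_unit : {in B, forall x, ~~ (p %| s + g x)%Z}.
Hypothesis tauD : forall N, (0 < N <= 8 * H ^ 6)%N -> (size (divisors N) <= D)%N.
Hypothesis H0 : (0 < H)%N.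

Let w (x : X) : 'F_p := (s + g x)%:~R.
Local Notation E nu := (energy (box (fun _ : 'I_nu => B)) (prod_map (fun _ : 'I_nu => w))).

Lemma energy2_le : (E 2 <= #|sols2 g B p s|)%N.
Proof.
have ff (i j : 'I_2) (u u' : {ffun 'I_2 -> X}) : val i = val j -> u j = u' j -> u i = u' i.
  by move=> /val_inj ->.
pose f (t : {ffun 'I_2 -> X} * {ffun 'I_2 -> X}) :=
  ((t.1 ord0, t.1 ord_max), (t.2 ord0, t.2 ord_max)).
rewrite /energy -(@card_in_imset _ _ f); last first.
  move=> [u v] [u' v'] _ _ [e1 e2 e3 e4].
  by congr (_, _); apply/ffunP => i; case: i => -[|[|//]] lti;
    [apply: ff e1 | apply: ff e2 | apply: ff e3 | apply: ff e4].
apply/subset_leq_card/subsetP => y /imsetP[[u v]].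
rewrite !inE /= => /and3P[/forallP uB /forallP vB /eqP e] ->.
rewrite /f /= !uB !vB /= -(intr_Fp_eq0 _ p_prime) rmorphB !rmorphM subr_eq0.
move/eqP: e; rewrite /prod_map !big_ord_recl !big_ord0 !mulr1 /w.
by rewrite (_ : lift ord0 ord0 = ord_max) //; apply/val_inj.
Qed.

Lemma energy3_le : (E 3 <= #|sols3 g B p s|)%N.
Proof.
have ff (i j : 'I_3) (u u' : {ffun 'I_3 -> X}) : val i = val j -> u j = u' j -> u i = u' i.
  by move=> /val_inj ->.
pose o1 : 'I_3 := lift ord0 ord0.
pose f (t : {ffun 'I_3 -> X} * {ffun 'I_3 -> X}) :=
  ((t.1 ord0, t.1 o1, t.1 ord_max), (t.2 ord0, t.2 o1, t.2 ord_max)).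
rewrite /energy -(@card_in_imset _ _ f); last first.
  move=> [u v] [u' v'] _ _ [e1 e2 e3 e4 e5 e6].
  by congr (_, _); apply/ffunP => i; case: i => -[|[|[|//]]] lti;
    [apply: ff e1 | apply: ff e2 | apply: ff e3 | apply: ff e4 | apply: ff e5 | apply: ff e6].
apply/subset_leq_card/subsetP => y /imsetP[[u v]].
rewrite !inE /= => /and3P[/forallP uB /forallP vB /eqP e] ->.
rewrite /f /= !uB !vB /= -(intr_Fp_eq0 _ p_prime) rmorphB !rmorphM subr_eq0.
move/eqP: e; rewrite /prod_map !big_ord_recl !big_ord0 !mulr1 /w !mulrA.
by rewrite (_ : lift ord0 (lift ord0 ord0) = ord_max) //; apply/val_inj.
Qed.

Lemma energy_window_le (nu : nat) : (2 <= nu <= 4)%N -> (H ^ window_exp nu <= p)%N ->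
  (E nu <= 50 * (1000 * (H ^ energy_exp nu * D ^ 2)))%N.
Proof.
have D1 : (1 <= D)%N.
  rewrite -(_ : size (divisors 1) = 1)%N //; apply: tauD => /=.
  by rewrite muln_gt0 expn_gt0 H0.
case: nu => [|[|[|[|[|//]]]]] // _ Hp.
- apply: leq_trans energy2_le _.
  apply: leq_trans (card_sols2 g_inj g_window p_prime B_unit tauD H0 Hp) _.
  have : (H ^ 2 * D <= H ^ 2 * D ^ 2)%N by rewrite leq_mul // -mulnn leq_pmulr.
  by rewrite /energy_exp /=; move: (H ^ 2 * D)%N (H ^ 2 * D ^ 2)%N; clear; lia.
- apply: leq_trans energy3_le _.
  exact: (card_sols3 g_inj g_window p_prime B_unit tauD H0 Hp).
have w0 : {in B, forall x, w x != 0}.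
  by move=> x xB; rewrite intr_Fp_eq0 // B_unit.
(* For four variables one is given up at the cost H^2, whence the exponent 5. *)
apply: leq_trans (energyS 3 w0) _.
have cB := card_window g_inj g_window.
apply: (@leq_trans (H ^ 2 * (50 * (1000 * (H ^ 3 * D ^ 2))))).
  apply: leq_mul; first by rewrite leq_exp2r.
  apply: leq_trans energy3_le _.
  exact: (card_sols3 g_inj g_window p_prime B_unit tauD H0 Hp).
by apply: eq_leq; rewrite /energy_exp /=; ring.
Qed.

End WindowEnergy.

(** [energy_box_le] makes all intervals and exponents equal to those of one index [i]; the common
    exponent is then removed at the cost |e i|. *)
Lemma energy_blocks_le (X : finType) (H D p nu : nat) (g : 'I_nu -> X -> int)
    (B : 'I_nu -> {set X}) (s e : 'I_nu -> int) (w : 'I_nu -> X -> 'F_p) :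
  (forall i x, w i x = (s i + g i x)%:~R ^ e i) ->
  (forall i, {in B i &, injective (g i)}) ->
  (forall i, {in B i, forall x, 0 <= g i x < H%:Z}) ->
  prime p ->
  (forall i, {in B i, forall x, ~~ (p %| s i + g i x)%Z}) ->
  (forall N, (0 < N <= 8 * H ^ 6)%N -> (size (divisors N) <= D)%N) ->
  (0 < H)%N -> (2 <= nu <= 4)%N -> (H ^ window_exp nu <= p)%N ->
  (forall i, e i != 0) ->
  (energy (box B) (prod_map w) <=
   (\sum_i `|e i|) * (50 * (1000 * (H ^ energy_exp nu * D ^ 2))))%N.
Proof.
move=> wE g_inj g_win pp B_unit tauD H0 nu4 Hp e0.
pose v i x : 'F_p := (s i + g i x)%:~R.
have v0 i : {in B i, forall x, v i x != 0}.
  by move=> x xB; rewrite intr_Fp_eq0 // B_unit.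
have I0 : (0 < #|'I_nu|)%N by rewrite card_ord; case/andP: nu4 => /ltnW.
apply: leq_trans (energy_box_le I0 _) _ => [i x xB|].
  by rewrite wE expfz_neq0 // v0.
rewrite big_distrl; apply: leq_sum => i _ /=.
have -> : energy (box (fun _ : 'I_nu => B i)) (prod_map (fun _ : 'I_nu => w i)) =
    energy (box (fun _ : 'I_nu => B i)) (fun u => prod_map (fun _ : 'I_nu => v i) u ^ e i).
  rewrite /energy; apply: eq_card => t; rewrite !inE -!prod_map_exp /prod_map.
  by rewrite (eq_bigr _ (fun j _ => wE i (t.1 j))) (eq_bigr _ (fun j _ => wE i (t.2 j))).
apply: leq_trans (energy_exp_le (e0 i) (box_prod_map_neq0 (fun _ => v0 i))) _.
rewrite leq_mul2l; apply/orP; right.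
exact: (energy_window_le (g_inj i) (g_win i) pp (B_unit i) tauD H0 nu4 Hp).
Qed.

(** * Cauchy-Schwarz and the bilinear estimate for a character *)

Lemma Lagrange_identity (R : comPzRingType) (I : finType) (a b : I -> R) :
  \sum_i \sum_j (a i * b j - a j * b i) ^+ 2 =
  ((\sum_i a i ^+ 2) * (\sum_i b i ^+ 2) - (\sum_i a i * b i) ^+ 2) * 2.
Proof.
transitivity (\sum_i (a i ^+ 2 * (\sum_j b j ^+ 2) + b i ^+ 2 * (\sum_j a j ^+ 2) -
    a i * b i * ((\sum_j a j * b j) * 2))).
  apply: eq_bigr => i _; rewrite mulr_suml !mulr_sumr -big_split -sumrB /=.
  by apply: eq_bigr => j _; ring.
by rewrite sumrB big_split /= -!mulr_suml; ring.
Qed.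

(** The passage to moduli comes first, since the squares in [Lagrange_identity] are nonnegative only
    for real entries. *)
Lemma Cauchy_Schwarz_sum (C : numClosedFieldType) (I : finType) (x y : I -> C) :
  `|\sum_i x i * y i| ^+ 2 <= (\sum_i `|x i| ^+ 2) * (\sum_i `|y i| ^+ 2).
Proof.
apply: (@le_trans _ _ ((\sum_i `|x i| * `|y i|) ^+ 2)).
  rewrite lerXn2r ?nnegrE ?normr_ge0 ?sumr_ge0 // => [i _|]; first by rewrite mulr_ge0.
  by apply: le_trans (ler_norm_sum _ _ _) _; apply: ler_sum => i _; rewrite normrM.
rewrite -subr_ge0 -(@pmulr_lge0 _ 2) // -Lagrange_identity.
apply: sumr_ge0 => i _; apply: sumr_ge0 => j _.
by rewrite real_exprn_even_ge0 // rpredB // rpredM // normr_real.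
Qed.

Section Character.
Variables (C : numClosedFieldType) (F : finFieldType) (chi : F -> C).
Hypothesis chi1 : chi 1 = 1.
Hypothesis chiM : {morph chi : x y / x * y}.
Hypothesis chi0 : chi 0 = 0.

Lemma character_norm1 x : x != 0 -> `|chi x| = 1.
Proof.
move=> x0.
have c0 : chi x != 0.
  apply/eqP => c0; have := oner_neq0 C.
  by rewrite -chi1 -(mulfV x0) chiM c0 mul0r eqxx.
have chiX n : chi (x ^+ n) = chi x ^+ n.
  by elim: n => [|n IH]; rewrite ?expr0 // !exprS chiM IH.
have F1 : (1 < #|F|)%N by apply: finNzRing_gt1.
have h : `|chi x| ^+ #|F|.-1 = 1.
  have n0 : `|chi x| != 0 by rewrite normr_eq0.
  apply: (mulfI n0); rewrite -exprS prednK ?(ltnW F1) // mulr1 -normrX -chiX.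
  by rewrite expf_card.
by apply/eqP; rewrite -(@pexpr_eq1 _ _ #|F|.-1) ?h // -ltnS prednK // ltnW.
Qed.

Lemma character_conj x : (chi x)^* = chi x^-1.
Proof.
have [->|x0] := eqVneq x 0; first by rewrite invr0 chi0 rmorph0.
have c0 : chi x != 0 by rewrite -normr_eq0 character_norm1 ?oner_eq0.
apply: (mulfI c0); rewrite -normCK character_norm1 // expr1n -chiM mulfV //.
Qed.

Hypothesis chi_nontrivial : exists2 x : F, x != 0 & chi x <> 1.

Lemma sum_character : \sum_t chi t = 0.
Proof.
have [x x0 xn] := chi_nontrivial.
have e : chi x * (\sum_t chi t) = \sum_t chi t.
  rewrite big_distrr /= [RHS](reindex (fun t => x * t)) /=.
    by apply: eq_bigr => t _; rewrite chiM.
  by exists (fun t => x^-1 * t) => t _; rewrite ?mulKf ?mulVKf.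
apply/eqP; have : (chi x - 1) * (\sum_t chi t) = 0 by rewrite mulrBl e mul1r subrr.
by move=> /eqP; rewrite mulf_eq0 subr_eq0 => /orP[/eqP|].
Qed.

(* For v != v', u |-> (u v + lam) / (u v' + lam) maps F minus a point
   bijectively to F minus v / v'. *)
Lemma sum_character_affine (lam v v' : F) : lam != 0 -> v != 0 -> v' != 0 ->
  \sum_u chi (u * v + lam) * (chi (u * v' + lam))^* =
  (#|F| * (v == v'))%:R - chi v * (chi v')^*.
Proof.
move=> l0 v0 v'0; have [<-|nvv'] := eqVneq v v'.
  rewrite -normCK character_norm1 // expr1n muln1.
  rewrite (bigD1 (- lam / v)) //= divfK // addNr chi0 mul0r add0r.
  rewrite (eq_bigr (fun _ => 1)) => [|u un]; last first.
    rewrite -normCK character_norm1 ?expr1n //; apply: contraNneq un => e.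
    by apply/eqP/(mulIf v0); rewrite divfK //; apply/eqP; rewrite -addr_eq0 e.
  rewrite sumr_const cardC1 -[in RHS](prednK (ltnW (finNzRing_gt1 F))).
  by rewrite mulrSr addrK.
rewrite muln0 sub0r.
pose f u := (u * v + lam) / (u * v' + lam).
pose h t := lam * (1 - t) / (t * v' - v).
have d0 : v' - v != 0 by rewrite subr_eq0 eq_sym.
(* The omitted [v / v'] is the value of the quotient at infinity. *)
have : \sum_(t | t != v / v') chi t = - (chi v * (chi v')^*).
  apply/eqP; rewrite -addr_eq0 addrC character_conj -chiM.
  by have := sum_character; rewrite (bigD1 (v / v')) //= => ->.
rewrite (reindex_onto f h) => [<-|t]; last first.
  move=> tn.
  have t0 : t * v' - v != 0.
    rewrite subr_eq0; apply: contraNneq tn => <-; by rewrite mulfK.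
  have -> : f (h t) = (lam * (v' - v) / (t * v' - v) * t) / (lam * (v' - v) / (t * v' - v)).
    by rewrite /f /h; congr (_ / _); field.
  by rewrite mulrAC mulfV ?mul1r // !mulf_neq0 ?invr_neq0.
rewrite (bigD1 (- lam / v')) //= divfK // addNr chi0 rmorph0 mulr0 add0r.
apply: eq_big => [u|u un]; last by rewrite character_conj -chiM.
(* At this pole division by 0 makes [f u] equal to 0, but [h 0] is - lam / v, so the condition of
   the reindexing excludes it. *)
have [->|un] := eqVneq u (- lam / v').
  rewrite /f /= divfK // addNr invr0 mulr0 /h mul0r sub0r subr0 mulr1 invrN mulrN.
  apply/esym/negP => /andP[_ /eqP]; rewrite mulNr => /oppr_inj /(mulfI l0) /invr_inj e.
  by rewrite e eqxx in nvv'.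
have u0 : u * v' + lam != 0.
  apply: contraNneq un => e; apply/eqP/(mulIf v'0); rewrite divfK //; apply/eqP.
  by rewrite -addr_eq0 e.
apply/esym/andP; split.
  apply/eqP => e; have : f u * (u * v' + lam) * v' = v / v' * (u * v' + lam) * v' by rewrite e.
  rewrite /f divfK // mulrAC divfK // => /eqP; rewrite -subr_eq0.
  rewrite (_ : _ - _ = lam * (v' - v)); last by ring.
  by rewrite mulf_eq0 (negPf l0) (negPf d0).
have -> : h (f u) = (lam * (v' - v) / (u * v' + lam) * u) / (lam * (v' - v) / (u * v' + lam)).
  by rewrite /f /h; congr (_ / _); field.
by rewrite mulrAC mulfV ?mul1r // !mulf_neq0 ?invr_neq0.
Qed.

(** Collect the [y] by the value u = a(y) and apply Cauchy-Schwarz in u, extending the sum to the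
    whole field. The coefficients give the energy of [a], and [sum_character_affine] gives #|F|
    times that of [b]. *)
Lemma bilinear_character_le (Y Z : finType) (S : {set Y}) (T : {set Z}) (a : Y -> F)
    (b : Z -> F) (rho : Y -> C) (sig : Z -> C) (lam : F) :
  lam != 0 -> {in T, forall z, b z != 0} ->
  (forall y, `|rho y| <= 1) -> (forall z, `|sig z| <= 1) ->
  `|\sum_(y in S) \sum_(z in T) rho y * sig z * chi (a y * b z + lam)| ^+ 2 <=
  (#|F| * energy S a * energy T b)%:R.
Proof.
move=> l0 b0 rho1 sig1.
pose alpha u := \sum_(y in S | a y == u) rho y.
pose gamma u := \sum_(z in T) sig z * chi (u * b z + lam).
have -> : \sum_(y in S) \sum_(z in T) rho y * sig z * chi (a y * b z + lam) =
    \sum_u alpha u * gamma u.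
  rewrite (partition_big a predT) //=; apply: eq_bigr => u _.
  rewrite mulr_suml; apply: eq_bigr => y /andP[_ /eqP ->].
  by rewrite mulr_sumr; apply: eq_bigr => z _; rewrite mulrA.
apply: le_trans (Cauchy_Schwarz_sum _ _) _.
rewrite mulnAC mulnC natrM.
have s0 (x : F -> C) : 0 <= \sum_i `|x i| ^+ 2.
  by apply: sumr_ge0 => i _; rewrite exprn_ge0.
apply: ler_pM => //.
  rewrite energyE natr_sum; apply: ler_sum => u _.
  rewrite natrX lerXn2r ?nnegrE ?normr_ge0 //.
  apply: le_trans (ler_norm_sum _ _ _) _.
  apply: (@le_trans _ _ (\sum_(y in S | a y == u) 1)); first exact: ler_sum.
  rewrite le_eqVlt -sum1_card natr_sum; apply/orP; left; apply/eqP.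
  by apply: eq_bigl => y; rewrite inE.
pose delta := \sum_(z in T) sig z * chi (b z).
pose W := \sum_(z in T) \sum_(z' in T) sig z * (sig z')^* * (#|F| * (b z == b z'))%:R.
have eW : \sum_u `|gamma u| ^+ 2 + `|delta| ^+ 2 = W.
  transitivity (\sum_(z in T) \sum_(z' in T) sig z * (sig z')^* *
     (\sum_u chi (u * b z + lam) * (chi (u * b z' + lam))^*) + `|delta| ^+ 2).
    congr (_ + _).
    under eq_bigr do rewrite normCK rmorph_sum big_distrlr /=.
    rewrite exchange_big /=; apply: eq_bigr => z _.
    rewrite exchange_big /=; apply: eq_bigr => z' _.
    by rewrite mulr_sumr; apply: eq_bigr => u _; rewrite rmorphM mulrACA.
  rewrite normCK rmorph_sum big_distrlr -big_split /=; apply: eq_bigr => z zT.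
  rewrite -big_split /=; apply: eq_bigr => z' zT'.
  have -> : sig z * chi (b z) * (sig z' * chi (b z'))^* =
      sig z * (sig z')^* * (chi (b z) * (chi (b z'))^*) by rewrite rmorphM mulrACA.
  by rewrite sum_character_affine ?b0 // -mulrDr subrK.
apply: (@le_trans _ _ W); first by rewrite -eW lerDl exprn_ge0.
have W0 : 0 <= W by rewrite -eW addr_ge0 // exprn_ge0.
rewrite -(ger0_norm W0); apply: le_trans (ler_norm_sum _ _ _) _.
have -> : (#|F| * energy T b)%:R =
    \sum_(z in T) \sum_(z' in T) (#|F| * (b z == b z'))%:R :> C.
  rewrite /energy -[#|[set _ | _]|]sum1_card big_distrr /= natr_sum pair_big_dep /=.
  rewrite big_mkcond [RHS]big_mkcond; apply: eq_bigr => -[u v] _ /=.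
  rewrite inE /=; case: (u \in T) (v \in T) (b u == b v) => [] [] [] //=.
  by rewrite muln0.
apply: ler_sum => z _; apply: le_trans (ler_norm_sum _ _ _) _; apply: ler_sum => z' _.
rewrite !normrM norm_conjC [X in _ * X]ger0_norm ?ler0n // -[leRHS]mul1r.
rewrite ler_wpM2r ?ler0n // -[leRHS]mulr1.
by apply: ler_pM.
Qed.

End Character.

(** * Splitting the variables into two groups *)

Definition join_ffun (X : Type) (m n : nat) (u : {ffun 'I_m -> X}) (v : {ffun 'I_n -> X}) :
    {ffun 'I_(m + n) -> X} :=
  [ffun i => match split i with inl a => u a | inr b => v b end].

Lemma join_ffunl (X : Type) (m n : nat) (u : {ffun 'I_m -> X}) (v : {ffun 'I_n -> X}) i :
  join_ffun u v (lshift n i) = u i.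
Proof. by rewrite ffunE (unsplitK (inl _ i)). Qed.

Lemma join_ffunr (X : Type) (m n : nat) (u : {ffun 'I_m -> X}) (v : {ffun 'I_n -> X}) i :
  join_ffun u v (rshift m i) = v i.
Proof. by rewrite ffunE (unsplitK (inr _ i)). Qed.

Lemma box_join (X : finType) (m n : nat) (B : 'I_(m + n) -> {set X}) u v :
  (join_ffun u v \in box B) =
  (u \in box (fun i => B (lshift n i))) && (v \in box (fun i => B (rshift m i))).
Proof.
rewrite !inE; apply/forallP/andP => [h|[/forallP hu /forallP hv] i].
  split; apply/forallP => i; [have := h (lshift n i)|have := h (rshift m i)].
    by rewrite join_ffunl.
  by rewrite join_ffunr.
case: (split_ordP i) => j ->; first by rewrite join_ffunl.
by rewrite join_ffunr.
Qed.

Lemma sum_box_join (V : nmodType) (X : finType) (m n : nat) (B : 'I_(m + n) -> {set X})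
    (G : {ffun 'I_(m + n) -> X} -> V) :
  \sum_(u in box B) G u = \sum_(u in box (fun i => B (lshift n i)))
    \sum_(v in box (fun i => B (rshift m i))) G (join_ffun u v).
Proof.
rewrite pair_big /= (reindex (fun t => join_ffun t.1 t.2)) /=.
  by apply: eq_bigl => t; rewrite box_join.
exists (fun u : {ffun 'I_(m + n) -> X} =>
   ([ffun i => u (lshift n i)], [ffun i => u (rshift m i)])) => [[u v] _|u _].
  by congr (_, _); apply/ffunP => i; rewrite ffunE ?join_ffunl ?join_ffunr.
apply/ffunP => i; case: (split_ordP i) => j -> /=.
  by rewrite join_ffunl ffunE.
by rewrite join_ffunr ffunE.
Qed.

Lemma box_sum_le (C : numClosedFieldType) (F : finFieldType) (chi : F -> C)
    (X : finType) (m n : nat) (w : 'I_(m + n) -> X -> F) (B : 'I_(m + n) -> {set X})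
    (r : 'I_(m + n) -> X -> C) (lam : F) :
  chi 1 = 1 -> {morph chi : x y / x * y} -> chi 0 = 0 ->
  (exists2 x : F, x != 0 & chi x <> 1) -> lam != 0 ->
  (forall i, {in B i, forall x, w i x != 0}) -> (forall i x, `|r i x| <= 1) ->
  `|\sum_(u in box B) (\prod_i r i (u i)) * chi (prod_map w u + lam)| ^+ 2 <=
  (#|F| * energy (box (fun i => B (lshift n i))) (prod_map (fun i => w (lshift n i)))
        * energy (box (fun i => B (rshift m i))) (prod_map (fun i => w (rshift m i))))%:R.
Proof.
move=> c1 cM c0 cn l0 w0 r1; rewrite sum_box_join.
have prod1 (k : nat) (f : 'I_k -> C) : (forall i, `|f i| <= 1) -> `|\prod_i f i| <= 1.
  by move=> f1; rewrite normr_prod; apply: prodr_ile1 => i _; rewrite normr_ge0 f1.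
under eq_bigr => u _ do under eq_bigr => v _ do rewrite /prod_map !big_split_ord /=
  (eq_bigr _ (fun i _ => congr1 (r _) (join_ffunl u v i)))
  (eq_bigr _ (fun i _ => congr1 (r _) (join_ffunr u v i)))
  (eq_bigr _ (fun i _ => congr1 (w _) (join_ffunl u v i)))
  (eq_bigr _ (fun i _ => congr1 (w _) (join_ffunr u v i))).
apply: (bilinear_character_le c1 cM c0 cn _
  (prod_map (fun i => w (lshift n i))) (b := prod_map (fun i => w (rshift m i)))
  (rho := fun u => \prod_i r (lshift n i) (u i))
  (sig := fun v => \prod_i r (rshift m i) (v i)) l0).
- exact: box_prod_map_neq0 (fun i => w0 _).
- by move=> u; apply: prod1.
- by move=> v; apply: prod1.
Qed.

(** * Cutting the box into blocks *)

Lemma card_box (I X : finType) (B : I -> {set X}) : #|box B| = (\prod_i #|B i|)%N.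
Proof.
rewrite -sum1_card; under [RHS]eq_bigr do rewrite -sum1_card.
rewrite bigA_distr_big_dep; apply: eq_big => [u|u _]; last by rewrite big1.
by rewrite inE; apply/forallP/familyP.
Qed.

Lemma window_div (x H : nat) : (0 < H)%N -> 0 <= x%:Z - (H * (x %/ H))%N%:Z < H%:Z.
Proof.
move=> H0; have -> : x%:Z - (H * (x %/ H))%N%:Z = (x %% H)%N%:Z.
  by rewrite {1}(divn_eq x H) mulnC PoszD addrAC subrr add0r.
by rewrite ltz_nat ltn_mod H0.
Qed.

Section Blocks.
Variables (C : numClosedFieldType) (p h m n : nat) (chi : 'F_p -> C).
Hypothesis p_prime : prime p.
Hypothesis chi1 : chi 1 = 1.
Hypothesis chiM : {morph chi : x y / x * y}.
Hypothesis chi0 : chi 0 = 0.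
Hypothesis chi_nontrivial : exists2 x : 'F_p, x != 0 & chi x <> 1.
Variables (k e : 'I_(m + n) -> int) (r : 'I_(m + n) -> 'I_h -> C) (lam : 'F_p).
Hypothesis lam0 : lam != 0.
Hypothesis e0 : forall i, e i != 0.
Hypothesis r1 : forall i x, `|r i x| <= 1.

(** In this section [k i] is the first point of the interval, so offsets start at 0. *)
Definition unit_points (i : 'I_(m + n)) : {set 'I_h} :=
  [set x : 'I_h | ~~ (p %| k i + (x : nat)%:Z)%Z].

Definition box_term (u : {ffun 'I_(m + n) -> 'I_h}) : C :=
  (\prod_i r i (u i)) *
  chi (prod_map (fun i (x : 'I_h) => ((k i + (x : nat)%:Z)%:~R : 'F_p) ^ e i) u + lam).

(** Blocks have side [H1] in the first [m] variables and [H2] in the others, and [Q1], [Q2] count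
    the blocks along one side. Every block satisfies the same bound, and the triangle inequality
    costs the number of blocks. The numerical constant is a variable [c], which keeps a large
    numeral out of the terms. *)
Lemma box_sum_blocks_le (H1 H2 D c : nat) : (50 * 1000 <= c)%N ->
  (forall N, (0 < N <= 8 * h ^ 6)%N -> (size (divisors N) <= D)%N) ->
  (0 < H1 <= h)%N -> (0 < H2 <= h)%N -> (2 <= m <= 4)%N -> (2 <= n <= 4)%N ->
  (H1 ^ window_exp m <= p)%N -> (H2 ^ window_exp n <= p)%N ->
  exists Q1 Q2, [/\ (Q1 * H1 <= 2 * h)%N, (Q2 * H2 <= 2 * h)%N &
  `|\sum_(u in box unit_points) box_term u| ^+ 2 <=
  ((Q1 ^ m * Q2 ^ n) ^ 2 * (p *
    ((\sum_i `|e i|) * (c * (H1 ^ energy_exp m * D ^ 2))) *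
    ((\sum_i `|e i|) * (c * (H2 ^ energy_exp n * D ^ 2)))))%:R].
Proof.
move=> c50 tauD /andP[H10 H1h] /andP[H20 H2h] m4 n4 H1p H2p.
have {}c50 X : (50 * (1000 * X) <= c * X)%N by rewrite mulnA leq_mul2r c50 orbT.
pose Hs (i : 'I_(m + n)) := if split i is inl _ then H1 else H2.
have Hl i : Hs (lshift n i) = H1 by rewrite /Hs (unsplitK (inl _ i)).
have Hr i : Hs (rshift m i) = H2 by rewrite /Hs (unsplitK (inr _ i)).
have Hs0 i : (0 < Hs i)%N by rewrite /Hs; case: (split i).
(* The index of the block of a point is at most the point itself, hence still in ['I_h]. *)
pose qs (u : {ffun 'I_(m + n) -> 'I_h}) : {ffun 'I_(m + n) -> 'I_h} :=
  [ffun i => Ordinal (leq_ltn_trans (leq_div (u i) (Hs i)) (ltn_ord (u i)))].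
(* An incomplete last block is included; as H <= h, there are still at most 2 h / H blocks. *)
pose Qset (H : nat) := [set q : 'I_h | (q * H < h)%N].
have Qcard H : (0 < H <= h)%N -> (#|Qset H| * H <= 2 * h)%N.
  move=> /andP[H0 Hh].
  suff : (#|Qset H| <= ((h.-1) %/ H).+1)%N.
    move=> le; apply: leq_trans (leq_mul le (leqnn H)) _; rewrite mulSn mul2n -addnn leq_add //.
    by rewrite (leq_trans (leq_divM _ _)) // leq_pred.
  rewrite -(size_iota 0 (h.-1 %/ H).+1) -[size _]muln1.
  apply: (card_fibers (f := fun q : 'I_h => q : nat)) => q; rewrite inE => qH.
    rewrite mem_iota /= add0n ltnS leq_divRL //.
    by rewrite -ltnS (ltn_predK qH).
  apply: card_le1_eq => a b; rewrite !inE => /andP[_ /eqP ea] /andP[_ /eqP eb].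
  by apply/val_inj; rewrite /= ea eb.
exists #|Qset H1|, #|Qset H2|; split; first by rewrite Qcard // H10.
  by rewrite Qcard // H20.
set M := (p * _ * _)%N.
pose B (q : {ffun 'I_(m + n) -> 'I_h}) i : {set 'I_h} :=
  [set x in unit_points i | ((x : nat) %/ Hs i == q i :> nat)%N].
have QsE : #|box (fun i => Qset (Hs i))| = (#|Qset H1| ^ m * #|Qset H2| ^ n)%N.
  rewrite card_box big_split_ord /=; congr (_ * _)%N.
    by under eq_bigr do rewrite Hl; rewrite prod_nat_const card_ord.
  by under eq_bigr do rewrite Hr; rewrite prod_nat_const card_ord.
rewrite (partition_big qs (fun q => q \in box (fun i => Qset (Hs i)))) /=; last first.
  move=> u _; rewrite inE; apply/forallP => i; rewrite !inE ffunE /=.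
  exact: leq_ltn_trans (leq_divM _ _) (ltn_ord _).
have blockle (q : {ffun 'I_(m + n) -> 'I_h}) : `|\sum_(u in box unit_points | qs u == q) box_term u| ^+ 2 <= M%:R.
  have -> : \sum_(u in box unit_points | qs u == q) box_term u = \sum_(u in box (B q)) box_term u.
    apply: eq_bigl => u; rewrite !inE; apply/andP/forallP.
      by move=> [/forallP h1 /eqP <-] i; rewrite inE h1 ffunE /=.
    move=> h1; split; first by apply/forallP => i; case/setIdP: (h1 i).
    by apply/eqP/ffunP => i; rewrite ffunE; apply/val_inj; case/setIdP: (h1 i) => _ /eqP.
  pose s i := k i + (Hs i * q i)%N%:Z; pose g i (x : 'I_h) := (x : nat)%:Z - (Hs i * q i)%N%:Z.
  have sg i (x : 'I_h) : k i + (x : nat)%:Z = s i + g i x by rewrite /s /g addrACA subrr addr0 // addrA addrAC addrK.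
  have g_inj i : {in B q i &, injective (g i)}.
    by move=> x y _ _ /addIr [] /val_inj.
  have g_win i : {in B q i, forall x, 0 <= g i x < (Hs i)%:Z}.
    move=> x /setIdP[_ /eqP qx].
    by rewrite /g -qx; apply: window_div.
  have B_unit i : {in B q i, forall x, ~~ (p %| s i + g i x)%Z}.
    by move=> x; rewrite inE -sg => /andP[]; rewrite inE.
  have w0 i : {in B q i, forall x : 'I_h, ((k i + (x : nat)%:Z)%:~R : 'F_p) ^ e i != 0}.
    by move=> x xB; rewrite expfz_neq0 // intr_Fp_eq0 // sg B_unit.
  apply: le_trans (box_sum_le chi1 chiM chi0 chi_nontrivial lam0 w0 r1) _.
  rewrite ler_nat card_Fp // /M.
  have tau' H : (H <= h)%N -> forall N, (0 < N <= 8 * H ^ 6)%N -> (size (divisors N) <= D)%N.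
    move=> Hh N /andP[N0 N8]; apply: tauD; rewrite N0 (leq_trans N8) //.
    by rewrite leq_mul2l leq_exp2r // Hh orbT.
  have el : (\sum_(i < m) `|e (lshift n i)| <= \sum_i `|e i|)%N by rewrite big_split_ord leq_addr.
  have er : (\sum_(i < n) `|e (rshift m i)| <= \sum_i `|e i|)%N by rewrite big_split_ord leq_addl.
  apply: leq_mul.
    apply: leq_mul => //.
    apply: leq_trans (leq_mul el (c50 _)).
    apply: (@energy_blocks_le _ H1 D p m (fun i => g (lshift n i)) (fun i => B q (lshift n i))
       (fun i => s (lshift n i)) (fun i => e (lshift n i))) => //.
    - by move=> i x; rewrite sg.
    - by move=> i x xB; have := g_win _ x xB; rewrite Hl.
    - exact: tau'.
  apply: leq_trans (leq_mul er (c50 _)).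
  apply: (@energy_blocks_le _ H2 D p n (fun i => g (rshift m i)) (fun i => B q (rshift m i))
     (fun i => s (rshift m i)) (fun i => e (rshift m i))) => //.
  - by move=> i x; rewrite sg.
  - by move=> i x xB; have := g_win _ x xB; rewrite Hr.
  - exact: tau'.
have normle (q : {ffun 'I_(m + n) -> 'I_h}) : `|\sum_(u in box unit_points | qs u == q) box_term u| <= sqrtC M%:R.
  by rewrite -(@ler_pXn2r _ 2) // ?nnegrE ?normr_ge0 ?sqrtC_ge0 ?ler0n // sqrtCK.
apply: (@le_trans _ _ ((\sum_(q in box (fun i => Qset (Hs i))) sqrtC M%:R) ^+ 2)).
  have S0 : 0 <= \sum_(q in box (fun i => Qset (Hs i))) sqrtC (M%:R : C).
    by apply: sumr_ge0 => q _; rewrite sqrtC_ge0 ler0n.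
  rewrite ler_pXn2r ?nnegrE //.
  by apply: le_trans (ler_norm_sum _ _ _) _; apply: ler_sum => q _; apply: normle.
by rewrite sumr_const QsE -[sqrtC _ *+ _]mulr_natl exprMn sqrtCK -natrX -natrM.
Qed.

End Blocks.

From mathcomp Require Import all_classical all_reals all_analysis.
From mathcomp Require Import complex.

Import Order.TTheory GRing.Theory Num.Theory.
Import numFieldNormedType.Exports.

(** * Real bounds for divisors and blocks *)

Lemma powR_root (R : realType) (x a b : R) (n : nat) : 0 <= x -> a = b * n%:R ->
  x `^ a = (x `^ b) ^+ n.
Proof. by move=> x0 ->; rewrite powRrM powR_mulrn // powR_ge0. Qed.

Lemma divisors_le_powR (R : realType) (eps : R) : 0 < eps ->
  exists2 K : R, 0 < K & forall h, (0 < h)%N -> exists D : nat,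
    (forall N, (0 < N <= 8 * h ^ 6)%N -> (size (divisors N) <= D)%N) /\
    D%:R ^+ 2 <= K * h%:R `^ eps.
Proof.
(* D^k = O(h^6) gives D^2 = O(h^(12 / k)), and 12 / k <= eps. *)
move=> eps0; pose k := Num.bound (12 / eps).
have kgt : 12 / eps < k%:R by apply: archi_boundP; rewrite divr_ge0 // ltW.
have k0 : 0 < k%:R :> R by apply: le_lt_trans kgt; rewrite divr_ge0 // ltW.
have [C0 tau] := size_divisors_pow k.
pose K : R := (8 * C0.+1)%N%:R `^ (2 / k%:R).
exists K; first by rewrite powR_gt0 // ltr0n muln_gt0.
move=> h h0.
pose D := (\max_(i < (8 * h ^ 6).+1 | (0 < i)%N) size (divisors i))%N.
have Dk : (D ^ k <= 8 * C0.+1 * h ^ 6)%N.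
  rewrite /D; elim/big_ind: _ => [|x y hx hy|i i0].
  - by rewrite exp0n // -(ltr0n R).
  - by rewrite /maxn; case: ifP.
  apply: leq_trans (tau _ i0) _; rewrite -mulnA mulnCA.
  by apply: leq_mul => //; rewrite -ltnS.
exists D; split.
  move=> N /andP[N0 N8].
  exact: (@leq_bigmax_cond _ (fun i : 'I_(8 * h ^ 6).+1 => (0 < i)%N)
    (fun i => size (divisors i)) (Ordinal (N8 : (N < (8 * h ^ 6).+1)%N)) N0).
have h1 : 1 <= h%:R :> R by rewrite ler1n.
have kn0 : k%:R != 0 :> R by rewrite gt_eqF.
have -> : D%:R ^+ 2 = (D%:R ^+ k) `^ (2 / k%:R) :> R.
  rewrite -!powR_mulrn // -powRrM; congr (_ `^ _); by rewrite mulrCA mulfV // mulr1.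
apply: (@le_trans _ _ (((8 * C0.+1)%N%:R * h%:R ^+ 6) `^ (2 / k%:R))).
  apply: ge0_ler_powR.
  - by rewrite divr_ge0.
  - by rewrite nnegrE exprn_ge0.
  - by rewrite nnegrE; apply: mulr_ge0 => //; apply: exprn_ge0.
  - by rewrite -!natrX -natrM ler_nat.
rewrite powRM ?exprn_ge0 // ler_wpM2l ?powR_ge0 //.
rewrite -powR_mulrn // -powRrM; apply: ler_powR => //.
by rewrite mulrA -natrM ler_pdivrMr // mulrC -ler_pdivrMr // ltW.
Qed.

(** If [h] is too long, take the largest admissible [H]; then 2 H is not admissible. *)
Lemma block_length (c h p : nat) : (0 < c)%N -> (0 < h)%N -> (0 < p)%N ->
  exists H, [/\ (0 < H <= h)%N, (H ^ c <= p)%N &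
    if (h ^ c <= p)%N then H = h else (p < (2 * H) ^ c)%N].
Proof.
move=> c0 h0 p0; have [hp|hp] := leqP (h ^ c) p; first by exists h; rewrite h0 leqnn.
have ex1 : exists H, (H ^ c <= p)%N by exists 1; rewrite exp1n.
have bd H : (H ^ c <= p)%N -> (H <= p)%N.
  by apply: leq_trans; case: H => // H; rewrite -{1}[H.+1]expn1 leq_pexp2l.
case: (ex_maxnP ex1 bd) => H Hp Hmax.
have H0 : (0 < H)%N by apply: Hmax; rewrite exp1n.
exists H; split => //.
  rewrite H0 leqNgt; apply/negP => hH; move: hp; rewrite ltnNge => /negP; apply.
  by rewrite (leq_trans _ Hp) // leq_exp2r // ltnW.
rewrite ltnNge; apply/negP => /Hmax; rewrite leqNgt => /negP; apply.
by rewrite ltn_Pmull.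
Qed.

(* With y = p^(1/8) and z = h^(1/2), this bounds the square root of the energy
   summed over all the blocks. *)
Definition block_factor (R : realType) (nu h p : nat) (y z : R) : R :=
  if (h ^ window_exp nu <= p)%N then z ^+ energy_exp nu
  else z ^+ (2 * nu) / y ^+ (if nu == 2 then 4 else 3).

Lemma block_factor_gt0 (R : realType) (nu h p : nat) (y z : R) : 0 < y -> 0 < z ->
  0 < block_factor nu h p y z.
Proof. by move=> y0 z0; rewrite /block_factor; case: ifP => _; rewrite ?divr_gt0 ?exprn_gt0. Qed.

(** If [h] is admissible, then H = h and Q <= 2. Otherwise write the left side as (Q H)^(2 nu)
    divided by H^2 for nu = 2 and by H^3 for nu = 3, 4; then use Q H <= 2 z^2, and y^4 <= 2 H or y^2
    <= 2 H respectively. *)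
Lemma block_factorP (R : realType) (nu h p : nat) (y z : R) :
  0 < y -> 0 < z -> y ^+ 8 = p%:R -> z ^+ 2 = h%:R -> (2 <= nu <= 4)%N ->
  (0 < h)%N -> (0 < p)%N ->
  exists H, [/\ (0 < H <= h)%N, (H ^ window_exp nu <= p)%N & forall Q, (Q * H <= 2 * h)%N ->
    (Q%:R ^+ nu) ^+ 2 * H%:R ^+ energy_exp nu <= (4 ^+ nu * block_factor nu h p y z) ^+ 2].
Proof.
move=> y0 z0 yp zh nu4 h0 p0.
have [|H [H0h Hp Hc]] := @block_length (window_exp nu) h p _ h0 p0.
  by rewrite /window_exp; case: ifP.
exists H; split => // Q QH; rewrite /block_factor.
have hR : 0 < h%:R :> R by rewrite ltr0n.
case: ifP Hc => [hp eH|hp pH].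
  rewrite eH in QH *; rewrite leq_pmul2r // in QH.
  rewrite -zh [(4 ^+ nu * _) ^+ 2]exprMn -(exprM z 2) -(exprM z _ 2) [(2 * _)%N]mulnC.
  have Q4 : (Q ^ nu <= 4 ^ nu)%N.
    by rewrite leq_exp2r ?(leq_trans QH) //; case: (nu) nu4.
  rewrite ler_wpM2r ?exprn_ge0 ?(ltW z0) // lerXn2r ?nnegrE ?exprn_ge0 //.
  by rewrite -!natrX ler_nat.
have H0 : 0 < H%:R :> R by rewrite ltr0n; case/andP: H0h.
have QHR : Q%:R * H%:R <= 2 * z ^+ 2 by rewrite zh -!natrM ler_nat.
have QHR0 : 0 <= Q%:R * H%:R :> R by rewrite mulr_ge0.
have z20 : 0 <= 2 * z ^+ 2 by rewrite mulr_ge0 ?exprn_ge0 ?ltW.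
have pow m : (Q%:R * H%:R) ^+ m <= (2 * z ^+ 2) ^+ m by rewrite lerXn2r ?nnegrE.
have y2H : nu != 2 -> y ^+ 2 <= 2 * H%:R.
  move=> n2; rewrite /window_exp (negPf n2) in pH.
  rewrite -(@ler_pXn2r _ 4) ?nnegrE ?mulr_ge0 ?exprn_ge0 ?(ltW y0) ?(ltW z0) //.
  by rewrite -exprM yp -natrM -natrX ler_nat ltnW.
case: nu nu4 hp pH y2H {Hp} => [|[|[|[|[|//]]]]] // _ hp pH y2H;
  rewrite /energy_exp /= ?addn0 ?addn1.
- have {}y2H : y ^+ 4 <= 2 * H%:R.
    rewrite -(@ler_pXn2r _ 2) ?nnegrE ?mulr_ge0 ?exprn_ge0 ?(ltW y0) ?(ltW z0) //.
    by rewrite -exprM yp -natrM -natrX ler_nat ltnW.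
  have y80 : 0 < y ^+ 8 by rewrite exprn_gt0.
  rewrite -(ler_pM2r y80).
  have -> : (4 ^+ 2 * (z ^+ 4 / y ^+ 4)) ^+ 2 * y ^+ 8 = 2 ^+ 8 * z ^+ 8.
    by field; rewrite gt_eqF.
  apply: (@le_trans _ _ (4 * (Q%:R * H%:R) ^+ 4)).
    rewrite (_ : 4 * _ = (Q%:R ^+ 2) ^+ 2 * H%:R ^+ 2 * (2 * H%:R) ^+ 2); last by ring.
    rewrite ler_wpM2l ?mulr_ge0 ?exprn_ge0 // (exprM y 4 2) lerXn2r ?nnegrE ?mulr_ge0 ?exprn_ge0 ?(ltW y0) ?(ltW z0) //.
  apply: (@le_trans _ _ (4 * (2 * z ^+ 2) ^+ 4)); first by rewrite ler_wpM2l.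
  rewrite exprMn -exprM mulrA ler_wpM2r ?exprn_ge0 ?(ltW y0) ?(ltW z0) //.
  by rewrite -!natrX -natrM ler_nat.
- have {}y2H := y2H erefl.
  have y60 : 0 < y ^+ 6 by rewrite exprn_gt0.
  rewrite -(ler_pM2r y60).
  have -> : (4 ^+ 3 * (z ^+ 6 / y ^+ 3)) ^+ 2 * y ^+ 6 = 2 ^+ 12 * z ^+ 12.
    by field; rewrite gt_eqF.
  apply: (@le_trans _ _ (8 * (Q%:R * H%:R) ^+ 6)).
    rewrite (_ : 8 * _ = (Q%:R ^+ 3) ^+ 2 * H%:R ^+ 3 * (2 * H%:R) ^+ 3); last by ring.
    rewrite ler_wpM2l ?mulr_ge0 ?exprn_ge0 // (exprM y 2 3) lerXn2r ?nnegrE ?mulr_ge0 ?exprn_ge0 ?(ltW y0) ?(ltW z0) //.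
  apply: (@le_trans _ _ (8 * (2 * z ^+ 2) ^+ 6)); first by rewrite ler_wpM2l.
  rewrite exprMn -exprM mulrA ler_wpM2r ?exprn_ge0 ?(ltW y0) ?(ltW z0) //.
  by rewrite (_ : 8 = 2 ^+ 3) -?exprD; [rewrite ler_weXn2l // ler1n|ring].
have {}y2H := y2H erefl.
have y60 : 0 < y ^+ 6 by rewrite exprn_gt0.
rewrite -(ler_pM2r y60).
have -> : (4 ^+ 4 * (z ^+ 8 / y ^+ 3)) ^+ 2 * y ^+ 6 = 2 ^+ 16 * z ^+ 16.
  by field; rewrite gt_eqF.
apply: (@le_trans _ _ (8 * (Q%:R * H%:R) ^+ 8)).
  rewrite (_ : 8 * _ = (Q%:R ^+ 4) ^+ 2 * H%:R ^+ 5 * (2 * H%:R) ^+ 3); last by ring.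
  rewrite ler_wpM2l ?mulr_ge0 ?exprn_ge0 // (exprM y 2 3) lerXn2r ?nnegrE ?mulr_ge0 ?exprn_ge0 ?(ltW y0) ?(ltW z0) //.
apply: (@le_trans _ _ (8 * (2 * z ^+ 2) ^+ 8)); first by rewrite ler_wpM2l.
rewrite exprMn -exprM mulrA ler_wpM2r ?exprn_ge0 ?(ltW y0) ?(ltW z0) //.
by rewrite (_ : 8 = 2 ^+ 3) -?exprD; [rewrite ler_weXn2l // ler1n|ring].
Qed.

(** * The character sum over a cube *)

Local Open Scope classical_set_scope.
Local Open Scope complex_scope.

Lemma charsum_box (R : realType) (p m n h : nat) (lambda : int) (chi : 'F_p -> R[i])
    (rho : 'I_(m + n) -> R -> R[i]) (e k : 'I_(m + n) -> int) :
  prime p -> (0 < h)%N ->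
  charsum lambda chi rho e (cube k h) =
  \sum_(u in box (unit_points p h (fun j => k j + 1)))
    box_term chi (fun j => k j + 1) e
      (fun j (x : 'I_h) => rho j (k j + 1 + (x : nat)%:Z)%:~R) lambda%:~R u.
Proof.
move=> pp h0; rewrite -big_enum /= fsbig_seq ?enum_uniq //.
pose f (u : {ffun 'I_(m + n) -> 'I_h}) : {ffun 'I_(m + n) -> int} :=
  [ffun j => k j + 1 + (u j : nat)%:Z].
have unitE (x : {ffun 'I_(m + n) -> int}) :
    (p %| \prod_(j < m + n) x j)%Z = ~~ [forall j, ~~ (p %| x j)%Z].
  rewrite -intr_Fp_eq0 // rmorph_prod; apply/idP/idP.
    move/prodf_eq0 => [j _]; rewrite intr_Fp_eq0 // => pj.
    by apply/negP => /forallP /(_ j); rewrite pj.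
  rewrite negb_forall => /existsP[j]; rewrite negbK => pj.
  by apply/prodf_eq0; exists j; rewrite ?intr_Fp_eq0.
rewrite /charsum (@reindex_fsbig _ _ _ _ _ f [set` enum (box (unit_points p h (fun j => k j + 1)))]).
  apply: eq_fsbigr => u _; rewrite /box_term /prod_map.
  by congr (_ * chi (_ + _)); apply: eq_bigr => j _; rewrite ffunE.
split.
- move=> u /=; rewrite mem_enum inE => /forallP uB; split=> /=.
    by move=> j; rewrite ffunE; move: (nat_of_ord (u j)) (ltn_ord (u j)) (k j); clear; lia.
  rewrite unitE negbK; apply/forallP => j; rewrite ffunE.
  by have := uB j; rewrite inE.
- move=> u v _ _ /ffunP uv; apply/ffunP => j; apply/val_inj.
  by have := uv j; rewrite !ffunE => /addrI [].
move=> x [xB /=]; rewrite unitE negbK => /forallP xu.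
have xj j : exists2 i : 'I_h, x j = k j + 1 + (i : nat)%:Z & true.
  have /andP[lo hi] := xB j.
  have lt : (`|(x j - (k j + 1))%R| < h)%N.
    by move: (x j) (k j) lo hi; clear; lia.
  by exists (Ordinal lt) => //=; move: (x j) (k j) lo {hi lt}; clear; lia.
pose u : {ffun 'I_(m + n) -> 'I_h} := [ffun j => s2val (cid2 (xj j))].
have uE j : x j = k j + 1 + (u j : nat)%:Z by rewrite ffunE; exact: s2valP (cid2 (xj j)).
exists u.
  rewrite /= mem_enum inE; apply/forallP => j; rewrite inE -uE; exact: xu.
by apply/ffunP => j; rewrite ffunE -uE.
Qed.

(** The norm of [R[i]] takes its values in [R[i]], while the estimates below are real. *)
Lemma norm_realE (R : realType) (z : R[i]) : exists2 N : R, 0 <= N & `|z| = N%:C.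
Proof. by rewrite normc_def; eexists; [|reflexivity]; apply: sqrtr_ge0. Qed.

(** The first bound on [N] is the trivial one, the number of points. The constant is at least 1 so
    that it can absorb that bound later. *)
Lemma charsum_le (R : realType) (m n : nat) (e : 'I_(m + n) -> int) (eps : R) :
  (2 <= m <= 4)%N -> (2 <= n <= 4)%N -> (forall j, e j != 0) -> 0 < eps ->
  exists2 C : R, 1 <= C &
    forall (p h : nat) (k : 'I_(m + n) -> int) (rho : 'I_(m + n) -> R -> R[i])
      (chi : 'F_p -> R[i]) (lambda : int),
      prime p -> (0 < h)%N -> (forall j x, `|rho j x| <= 1) ->
      mul_character chi -> nontrivial_character chi -> coprimez lambda p ->
      let y := p%:R `^ (1 / 8) in let z := h%:R `^ (1 / 2) in
      exists N : R, [/\ `|charsum lambda chi rho e (cube k h)| = N%:C,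
        N <= z ^+ (2 * (m + n)) &
        N <= C * h%:R `^ eps * (y ^+ 4 * block_factor m h p y z * block_factor n h p y z)].
Proof.
move=> m4 n4 e0 eps0; have [K K0 tau] := divisors_le_powR eps0.
have [c c50] : exists c : nat, (50 * 1000 <= c)%N by exists (50 * 1000)%N.
pose E := (\sum_i `|e i|)%N.
(* The square root of the two energy constants, the factors from [block_factorP], and [K] for the
   divisor bound. *)
pose C := (E * c)%N%:R * (4 ^+ m * 4 ^+ n) * K.
exists (1 + C); first by rewrite lerDl !mulr_ge0 // ?exprn_ge0 // ltW.
move=> p h k rho chi lambda pp h0 rho1 [[chi1 chiM] chi0] chin cop y z.
have p0 : (0 < p)%N by apply: prime_gt0.
have y0 : 0 < y by rewrite powR_gt0 // ltr0n.
have z0 : 0 < z by rewrite powR_gt0 // ltr0n.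
have yp : y ^+ 8 = p%:R by rewrite -(@powR_root _ _ 1) ?powRr1 //; field.
have zh : z ^+ 2 = h%:R by rewrite -(@powR_root _ _ 1) ?powRr1 //; field.
have [N N0 NE] := norm_realE (charsum lambda chi rho e (cube k h)); exists N; split=> //.
  rewrite -lecR -NE (charsum_box _ _ _ _ _ pp h0).
  apply: le_trans (ler_norm_sum _ _ _) _.
  have le1 (u : {ffun 'I_(m + n) -> 'I_h}) : `|box_term chi (fun j => k j + 1) e
      (fun j (x : 'I_h) => rho j (k j + 1 + (x : nat)%:Z)%:~R) lambda%:~R u| <= 1.
    rewrite /box_term normrM mulr_ile1 // ?normr_prod.
      by apply: prodr_ile1 => j _; rewrite normr_ge0 rho1.
    set t := (_ + _); have [->|t0] := eqVneq t 0; first by rewrite chi0 normr0.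
    by rewrite (character_norm1 chi1 chiM).
  apply: le_trans (ler_sum _ (fun u _ => le1 u)) _.
  rewrite sumr_const exprM zh -natrX rmorph_nat ler_nat.
  by apply: leq_trans (max_card _) _; rewrite card_ffun !card_ord.
have [D [tauD DK]] := tau h h0.
have [H1 [H1h H1p Q1P]] := block_factorP y0 z0 yp zh m4 h0 p0.
have [H2 [H2h H2p Q2P]] := block_factorP y0 z0 yp zh n4 h0 p0.
have lam0 : lambda%:~R != 0 :> 'F_p.
  rewrite intr_Fp_eq0 //; apply/negP => pl.
  move: cop; rewrite coprimezE coprime_sym /= prime_coprime //.
  by move: pl; rewrite dvdzE /= => ->.
have [x x0 xn] := chin.
have := box_sum_blocks_le pp chi1 chiM chi0 (ex_intro2 _ _ x x0 xn) (fun j => k j + 1) lam0 e0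
  (r := fun j (x : 'I_h) => rho j (k j + 1 + (x : nat)%:Z)%:~R) (fun j x => rho1 j _)
  c50 tauD H1h H2h m4 n4 H1p H2p.
move=> [Q1 [Q2 [/Q1P q1 /Q2P q2]]]; rewrite -(charsum_box _ _ _ _ _ pp h0) NE.
move=> main.
have {}main : N ^+ 2 <= ((Q1 ^ m * Q2 ^ n) ^ 2 * (p *
    (E * (c * (H1 ^ energy_exp m * D ^ 2))) *
    (E * (c * (H2 ^ energy_exp n * D ^ 2)))))%:R.
  by rewrite -lecR rmorphXn /= rmorph_nat.
set bm := block_factor m h p y z in q1 *; set bn := block_factor n h p y z in q2 *.
have bm0 : 0 < bm by apply: block_factor_gt0.
have bn0 : 0 < bn by apply: block_factor_gt0.
have hpos : 0 <= h%:R `^ eps :> R by rewrite powR_ge0.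
apply: (@le_trans _ _ (C * h%:R `^ eps * (y ^+ 4 * bm * bn))); last first.
  rewrite ler_wpM2r ?mulr_ge0 ?exprn_ge0 ?(ltW y0) ?(ltW bm0) ?(ltW bn0) //.
  by rewrite ler_wpM2r // lerDr.
apply: (@le_trans _ _ ((E * c)%N%:R * (4 ^+ m * 4 ^+ n) * D%:R ^+ 2 * (y ^+ 4 * bm * bn))).
  rewrite -(@ler_pXn2r _ 2) ?nnegrE ?mulr_ge0 ?exprn_ge0 ?(ltW y0) ?(ltW bm0) ?(ltW bn0) //.
  apply: le_trans main _.
  rewrite !natrM !natrX -yp.
  have W0 : 0 <= (E%:R * c%:R) ^+ 2 * (D%:R ^+ 2) ^+ 2 * y ^+ 8 by rewrite !mulr_ge0 ?exprn_ge0 ?(ltW y0).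
  have b0 (a : R) (H j : nat) : 0 <= a ^+ 2 * H%:R ^+ j by rewrite mulr_ge0 ?sqr_ge0 ?exprn_ge0.
  have := ler_wpM2r W0 (ler_pM (b0 _ _ _) (b0 _ _ _) q1 q2).
  move: (Q1%:R ^+ m) (Q2%:R ^+ n) (H1%:R ^+ energy_exp m) (H2%:R ^+ energy_exp n) (4 ^+ m) (4 ^+ n) => a1 a2 h1 h2 f1 f2 le.
  apply: le_trans (le_trans _ le) _; rewrite le_eqVlt; apply/orP; left; apply/eqP; ring.
rewrite ler_wpM2r ?mulr_ge0 ?exprn_ge0 ?(ltW y0) ?(ltW bm0) ?(ltW bn0) //.
by rewrite /C -[leRHS]mulrA ler_wpM2l ?mulr_ge0 ?exprn_ge0.
Qed.

(** * Comparison with the claimed bound *)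

Lemma charsum_boundE (R : realType) (n h p : nat) :
  let y : R := p%:R `^ (1 / 8) in let z : R := h%:R `^ (1 / 2) in
  charsum_bound R n h p =
  match n with
  | 4 => z ^+ 4 * y ^+ 4 + z ^+ 8 * (y ^+ 4)^-1
  | 5 => z ^+ 5 * y ^+ 4 + z ^+ 8 * y + z ^+ 10 * (y ^+ 3)^-1
  | 6 => z ^+ 6 * y ^+ 4 + z ^+ 12 * (y ^+ 2)^-1
  | 7 => z ^+ 11 * y ^+ 2 + z ^+ 14 * y^-1
  | _ => 0
  end.
Proof.
move=> y z.
(* All real exponents become integer powers of [y] and [z], within reach of [ring] and [field]. *)
have yE a (j : nat) : a = 1 / 8 * j%:R -> p%:R `^ a = y ^+ j by move=> ->; apply: powR_root.
have zE a (j : nat) : a = 1 / 2 * j%:R -> h%:R `^ a = z ^+ j by move=> ->; apply: powR_root.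
case: n => [|[|[|[|[|[|[|[|n]]]]]]]] //; rewrite /charsum_bound ?powRN.
- rewrite (zE _ 4); last by field.
  rewrite (zE _ 8); last by field.
  by rewrite (yE _ 4); last by field.
- rewrite (zE _ 5); last by field.
  rewrite (zE _ 8); last by field.
  rewrite (zE _ 10); last by field.
  rewrite (yE (1 / 2) 4); last by field.
  rewrite -/y (yE _ 3); last by field.
  by [].
- rewrite (zE _ 6); last by field.
  rewrite (zE _ 12); last by field.
  rewrite (yE (1 / 2) 4); last by field.
  by rewrite (yE _ 2); last by field.
- rewrite (zE _ 11); last by field.
  rewrite (zE _ 14); last by field.
  rewrite -/y (yE _ 2); last by field.
  by [].
Qed.

(** For n <= 6, whether [h] is admissible for each group decides which term of the bound the product
    equals; n = 5 has three terms because its groups have different thresholds. *)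
Lemma charsum_bound_min (R : realType) (m n h p : nat) : (0 < h)%N -> (0 < p)%N ->
  (m, n) \in [:: (2, 2); (2, 3); (3, 3); (3, 4)] ->
  let y : R := p%:R `^ (1 / 8) in let z : R := h%:R `^ (1 / 2) in
  y ^+ 4 * block_factor m h p y z * block_factor n h p y z <= charsum_bound R (m + n) h p \/
  z ^+ (2 * (m + n)) <= charsum_bound R (m + n) h p.
Proof.
move=> h0 p0 mn y z.
have y0 : 0 < y by rewrite powR_gt0 // ltr0n.
have z0 : 0 < z by rewrite powR_gt0 // ltr0n.
have yn0 : y != 0 by rewrite gt_eqF.
have y1 : 1 <= y.
  by rewrite -[leLHS](@powRr0 _ p%:R); apply: ler_powR; rewrite ?ler1n.
have pos (j i : nat) : 0 <= z ^+ j * y ^+ i by rewrite mulr_ge0 // exprn_ge0 ?ltW.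
have posV (j i : nat) : 0 <= z ^+ j * (y ^+ i)^-1.
  by rewrite mulr_ge0 ?invr_ge0 // exprn_ge0 ?ltW.
have h42 : (h ^ 4 <= p)%N -> (h ^ 2 <= p)%N.
  by apply: leq_trans; rewrite leq_pexp2l.
rewrite charsum_boundE -/y -/z /block_factor /energy_exp /window_exp.
move: mn; rewrite !inE => /or4P[] /eqP[-> ->] /=; rewrite ?addn0 ?addn1.
- left; case: ifP => _.
    by rewrite [leLHS](_ : _ = z ^+ 4 * y ^+ 4) ?lerDl //; ring.
  by rewrite [leLHS](_ : _ = z ^+ 8 * (y ^+ 4)^-1) ?lerDr //; field.
- left; case: ifP => h2; case: ifP => h4.
  + rewrite [leLHS](_ : _ = z ^+ 5 * y ^+ 4); last by ring.
    by rewrite -addrA lerDl addr_ge0 ?posV //; apply: (pos 8 1).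
  + rewrite [leLHS](_ : _ = z ^+ 8 * y); last by field.
    by rewrite addrAC lerDr addr_ge0.
  + by rewrite (h42 h4) in h2.
  + rewrite [leLHS](_ : _ = z ^+ 10 * (y ^+ 3)^-1); last by field.
    by rewrite lerDr addr_ge0 //; apply: (pos 8 1).
- left; case: ifP => _.
    by rewrite [leLHS](_ : _ = z ^+ 6 * y ^+ 4) ?lerDl //; ring.
  by rewrite [leLHS](_ : _ = z ^+ 12 * (y ^+ 2)^-1) ?lerDr //; field.
case: ifP => _; last first.
  left; rewrite [leLHS](_ : _ = z ^+ 14 * (y ^+ 2)^-1); last by field.
  apply: (@le_trans _ _ (z ^+ 14 * y^-1)); last by rewrite lerDr.
  by rewrite ler_wpM2l ?exprn_ge0 ?(ltW z0) // lef_pV2 ?posrE ?exprn_gt0 // ler_eXnr.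
(* The product is z^8 y^4, at most z^11 y^2 when y^2 <= z^3, that is p^(1/6) <= h; otherwise the
   trivial z^14 is smaller than z^11 y^2. *)
have [yz|zy] := leP (y ^+ 2) (z ^+ 3); [left|right].
  apply: (@le_trans _ _ (z ^+ 11 * y ^+ 2)); last by rewrite lerDl; apply: (posV 14 1).
  rewrite [leLHS](_ : _ = z ^+ 8 * y ^+ 2 * y ^+ 2); last by ring.
  rewrite [leRHS](_ : _ = z ^+ 8 * y ^+ 2 * z ^+ 3); last by ring.
  by rewrite ler_wpM2l.
apply: (@le_trans _ _ (z ^+ 11 * y ^+ 2)); last by rewrite lerDl; apply: (posV 14 1).
rewrite [leLHS](_ : _ = z ^+ 11 * z ^+ 3); last by ring.
by rewrite ler_wpM2l ?exprn_ge0 ?(ltW z0) // ltW.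
Qed.

Theorem theorem6 (R : realType) (n : nat) (hn : (4 <= n <= 7)%N)
    (e : 'I_n -> int) (he : \prod_(j < n) e j != 0)
    (eps : R) (heps : 0 < eps) :
  exists2 C : R, 0 < C &
    forall (p : nat) (h : nat) (k : 'I_n -> int) (rho : 'I_n -> R -> R[i])
      (chi : 'F_p -> R[i]) (lambda : int),
      prime p ->
      (0 < h <= p)%N ->
      (forall j x, `|rho j x| <= 1) ->
      mul_character chi ->
      nontrivial_character chi ->
      coprimez lambda p ->
      `|charsum lambda chi rho e (cube k h)|
        <= (C * h%:R `^ eps * charsum_bound R n h p)%:C.
Proof.
(* Each [n] is written as a sum that computes to it, so [e] has the required type without a cast. *)
suff split_le m' n' (e' : 'I_(m' + n') -> int) :
    (m', n') \in [:: (2, 2); (2, 3); (3, 3); (3, 4)] -> \prod_j e' j != 0 ->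
    exists2 C : R, 0 < C & forall p h k rho (chi : 'F_p -> R[i]) lambda,
      prime p -> (0 < h <= p)%N -> (forall j x, `|rho j x| <= 1) ->
      mul_character chi -> nontrivial_character chi -> coprimez lambda p ->
      `|charsum lambda chi rho e' (cube k h)| <=
        (C * h%:R `^ eps * charsum_bound R (m' + n') h p)%:C.
  case: n hn e he => [|[|[|[|[|[|[|[|n]]]]]]]] // _ e he.
  - exact: (split_le 2 2 e).
  - exact: (split_le 2 3 e).
  - exact: (split_le 3 3 e).
  - exact: (split_le 3 4 e).
move=> mn /prodf_neq0 e0.
have [m4 n4] : (2 <= m' <= 4)%N /\ (2 <= n' <= 4)%N.
  by move: mn; rewrite !inE => /or4P[] /eqP[-> ->].
have [C C1 bound] := charsum_le m4 n4 (fun j => e0 j erefl) heps.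
exists C; first exact: lt_le_trans C1.
move=> p h k rho chi lambda pp /andP[h0 _] rho1 chiP chin cop.
have [N [-> N1 N2]] := bound p h k rho chi lambda pp h0 rho1 chiP chin cop.
rewrite lecR.
(* Needed for the trivial bound, which comes without this factor. *)
have heps1 : 1 <= C * h%:R `^ eps.
  rewrite -[leLHS]mulr1 ler_pM //.
  by rewrite -[leLHS](@powRr0 _ h%:R); apply: ler_powR; rewrite ?ler1n // ltW.
have c0 : 0 <= C * h%:R `^ eps by apply: le_trans heps1.
have [le|le] := charsum_bound_min R h0 (prime_gt0 pp) mn.
  by apply: le_trans N2 _; rewrite ler_wpM2l.
apply: le_trans N1 (le_trans le _).
by rewrite ler_peMl // (le_trans _ le) // exprn_ge0 // powR_ge0.
Qed.
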